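(* If $\Gamma_{12}^\star<\Gamma_{23}^\star$, or equivalently $2h_2>h_1+h_3$, then \[ \lim_{\beta\to\infty}e^{-\beta\Gamma_{13}^\star}\,\mathbb E_{\mathbf 1}^\beta[\tau_{\mathbf 3}]=\infty . \]
   Context: Let $K,L$ be positive integers and let $(V,E)$ be the $K\times L$ rectangular lattice graph with periodic boundary conditions: $V=(\mathbb Z/K\mathbb Z)\times(\mathbb Z/L\mathbb Z)$ and $E$ is the set of nearest-neighbour edges. Let $0<h_1<h_2<h_3<1$ be real numbers. Standing assumptions: (A) $K$ and $L$ are both greater than $\frac{3}{h_3-h_2}$ and greater than $\frac{3}{h_2-h_1}$; (B) $a(h_2-h_1)+b(h_3-h_2)\notin\mathbb Z$ for all $(a,b)\in\mathbb Z^2\setminus\{(0,0)\}$. All these parameters are fixed as $\beta\to\infty$. The configuration space is $\mathcal X=\{1,2,3\}^V$, with Hamiltonian \[ H(\sigma)=-\sum_{\{x,y\}\in E}\mathbf 1_{\{\sigma(x)=\sigma(y)\}}-\sum_{x\in V}h_{\sigma(x)} . \] For $i\in\{1,2,3\}$, $\mathbf i\in\mathcal X$ is the configuration with constant spin $i$. For $\beta>0$, $\{X_\beta(t)\}_{t\ge0}$ is the continuous-time Markov chain on $\mathcal X$ with jump rates $c_\beta(\sigma,\eta)=e^{-\beta[H(\eta)-H(\sigma)]_+}$ if $\sigma$ and $\eta$ differ at exactly one site, and $0$ otherwise, where $[t]_+=\max(t,0)$. $\mathbb E_\sigma^\beta$ denotes the expectation for the chain started at $\sigma$. $\tau_{\mathbf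 3}=\inf\{t\ge0:X_\beta(t)=\mathbf 3\}$. For $h\in(0,1)$ let $f(h)=4\ell_c-h(\ell_c(\ell_c-1)+1)$ with $\ell_c=\lceil 2/h\rceil$. For $1\le i<j\le3$ set $\Gamma_{ij}^\star=f(h_j-h_i)$. *)

(* Defs.v *)
From HB Require Import structures.
From mathcomp Require Import all_boot all_order all_algebra.
From mathcomp Require Import all_classical all_reals all_analysis.

Set Implicit Arguments.
Unset Strict Implicit.
Unset Printing Implicit Defensive.

Import Order.TTheory GRing.Theory Num.Theory.
Import numFieldNormedType.Exports.

Local Open Scope classical_set_scope.
Local Open Scope ring_scope.

(* The spins 1, 2, 3 are the elements 0, 1, 2 of 'I_3. *)
Definition spin := 'I_3.
Definition spin1 : spin := @Ordinal 3 0 isT.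
Definition spin2 : spin := @Ordinal 3 1 isT.
Definition spin3 : spin := @Ordinal 3 2 isT.

Section Lattice.
Variables K L : nat.

Definition site := ('I_K * 'I_L)%type.

(* ordS is the cyclic successor i |-> i + 1 mod K. *)
Definition neighbour : rel site := fun x y =>
  ((x.1 == y.1) && ((y.2 == ordS x.2) || (x.2 == ordS y.2))) ||
  ((x.2 == y.2) && ((y.1 == ordS x.1) || (x.1 == ordS y.1))).

Definition edges : {set {set site}} :=
  [set [set x; y] | x in [set: site], y in [set: site] & neighbour x y]%SET.

Definition config := {ffun site -> spin}.

Definition const_config (i : spin) : config := [ffun => i].

Definition monochromatic (s : config) (e : {set site}) : bool :=
  [forall x in e, forall y in e, s x == s y].

Definition hamiltonian (R : realType) (h : spin -> R) (s : config) : R :=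
  - (\sum_(e in edges) (monochromatic s e)%:R) - \sum_(x : site) h (s x).

Definition rate (R : realType) (h : spin -> R) (beta : R) (s t : config) : R :=
  if #|[set x | s x != t x]%SET| == 1%N
  then expR (- (beta * Num.max (hamiltonian h t - hamiltonian h s) 0))
  else 0.

End Lattice.

Section MarkovChain.
Variables (R : realType) (S : finType).

Definition generator (c : S -> S -> R) (x y : S) : R :=
  if x == y then - \sum_(z | z != x) c x z else c x y.

(* The Kolmogorov backward equation p' = Q p with p 0 = id. Its unique solution
   is the matrix exponential t |-> exp (t Q), which is defined for every real t,
   so requiring the equation also at t <= 0 does not restrict p on [0, +oo[. *)
Definition is_transition_function (c : S -> S -> R) (p : R -> S -> S -> R) :=
  (forall x y, p 0 x y = (x == y)%:R) /\
  (forall (t : R) x y, is_derive t (1 : R) (fun u : R => p u x y)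
     (\sum_(z : S) generator c x z * p t z y)).

(* X t is the state at time t; only the values X t with t >= 0 matter. *)
Definition is_markov_chain (c : S -> S -> R) (x0 : S)
    (d : measure_display) (Omega : measurableType d) (P : probability Omega R)
    (X : R -> Omega -> S) :=
  [/\ forall (t : R) (x : S), 0 <= t -> measurable [set w | X t w = x],
      forall (w : Omega) (t : R), 0 <= t -> \forall s \near t^'+, X s w = X t w
    & exists2 p, is_transition_function c p &
      forall (n : nat) (t : nat -> R) (x : nat -> S),
        t 0%N = 0 -> (forall k, t k <= t k.+1) ->
        P [set w | forall k, (k <= n)%N -> X (t k) w = x k] =
        ((x 0%N == x0)%:R *
         \prod_(k < n) p (t k.+1 - t k) (x k) (x k.+1))%:E ].

(* The infimum is +oo on the paths that never visit x. *)
Definition hitting_time (Omega : Type) (X : R -> Omega -> S) (x : S)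
    (w : Omega) : \bar R :=
  ereal_inf [set t%:E | t in [set t : R | 0 <= t /\ X t w = x]].

(* 'E_P is restricted to real-valued variables, a hitting time may be +oo. *)
Definition expected_hitting_time (d : measure_display)
    (Omega : measurableType d) (P : probability Omega R)
    (X : R -> Omega -> S) (x : S) : \bar R :=
  (\int[P]_w hitting_time X x w)%E.

End MarkovChain.

Definition critical_length (R : realType) (h : R) : R :=
  (Num.ceil (2 / h))%:~R.

Definition barrier (R : realType) (h : R) : R :=
  let l := critical_length h in 4 * l - h * (l * (l - 1) + 1).

Definition Gamma (R : realType) (h : spin -> R) (i j : spin) : R :=
  barrier (h j - h i).

(* Main.v *)
Require Import Defs.
From HB Require Import structures.
From mathcomp Require Import all_boot all_order all_algebra.
From mathcomp Require Import all_classical all_reals all_analysis.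
From mathcomp Require Import lra ring zify.

(* The chain is reversible, and mu(s) c(s, t) = exp (- beta max (H s) (H t)), so it is
   an electrical network. Started from 1, it follows with probability of order
   exp (- beta (Gamma12 - Gamma13)) the nucleation of a droplet of 2s instead of 3s; it
   is then trapped in the well of 2 for a time of order exp (beta Gamma23). The product
   of these two orders is much larger than exp (beta Gamma13) when Gamma12 < Gamma23.

   The function v = P_x(tau_2 < tau_3) satisfies L v >= - eps v with eps of order
   exp (- beta Gamma23), which gives P_1(tau_3 > t) >= exp (- eps t) v(1), hence
   E_1 tau_3 >= v(1) / (e eps). By Green's formula v(1) is a quotient of two
   capacities. The denominator and eps are bounded above by a cut: a set of
   configurations all of whose exits have energy at least that of the critical droplet,
   by the isoperimetric inequality. The numerator is bounded below by grounding all
   the configurations that contain a 3: from an Ising configuration of 1s and 2s an Ising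
   configuration of lower energy is reached at cost at most 2 - (h2 - h1), whereas
   creating a 3 is either dominated by a flip to an Ising configuration of lower energy
   or costs at least 2 - (h3 - h2), which is larger. *)

Set Implicit Arguments.
Unset Strict Implicit.
Unset Printing Implicit Defensive.

Import Order.TTheory GRing.Theory Num.Theory.
Import numFieldNormedType.Exports.

Local Open Scope classical_set_scope.
Local Open Scope ring_scope.

(** * Harmonic functions on a finite network *)

(** The number of configurations does not depend on beta, so factors depending only on it are
    harmless. Hence a unit drop of potential along a path may be charged to a single edge of the
    path, and the level set through that edge bounds the flow. The hypothesis acts twice. It makes
    Gamma23 exceed Gamma12, and it means h3 - h2 < h2 - h1, so that the height 2 - (h2 - h1) needed
    to leave an Ising trap other than 1 and 2 is smaller than the cost 2 - (h3 - h2) of a 3. The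
    obstacle is the flow from 1 to 2 once the 3s are grounded: part of the current leaks, so a
    single potential does not carry a conserved flow. The probabilities g and g' of meeting 1,
    respectively 2, first have a Wronskian current that is conserved in spite of the leak, and g' /
    (g + g') replaces the potential. This requires g + g' to be bounded below uniformly in beta on
    Ising configurations, which is an induction on energy with a bounded number of descents. *)

Section Network.
Variables (R : realFieldType) (S : finType) (a : S -> S -> R).
Hypothesis a_sym : forall x y, a x y = a y x.
Hypothesis a_ge0 : forall x y, 0 <= a x y.
Hypothesis a_connected : forall x y, connect (fun x y => 0 < a x y) x y.

(** This is the generator multiplied by the reversible measure, hence symmetric for the counting
    measure. *)
Definition lap (u : S -> R) (x : S) : R := \sum_y a x y * (u y - u x).

(** The currents inside [A] cancel in pairs; only those that leave [A] survive. *)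
Lemma antisym_flow (j : S -> S -> R) (A : pred S) :
  (forall x y, j x y = - j y x) ->
  \sum_(x in A) \sum_y j x y = \sum_(x in A) \sum_(y | y \notin A) j x y.
Proof.
move=> anti.
under eq_bigr => x _ do rewrite (bigID A) /=.
rewrite big_split /=.
suff -> : \sum_(x in A) \sum_(y in A) j x y = 0 by rewrite add0r.
set s := LHS.
suff : s = - s by move=> e; lra.
rewrite {1}/s exchange_big /= /s -sumrN.
by apply: eq_bigr => x _; rewrite -sumrN; apply: eq_bigr => y _.
Qed.

Lemma antisym_sum0 (j : S -> S -> R) :
  (forall x y, j x y = - j y x) -> \sum_x \sum_y j x y = 0.
Proof.
move=> anti; rewrite (antisym_flow predT anti).
by rewrite big1 // => x _; rewrite big1.
Qed.

Lemma lap_flow (u : S -> R) (A : pred S) :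
  \sum_(x in A) lap u x = \sum_(x in A) \sum_(y | y \notin A) a x y * (u y - u x).
Proof. by apply: antisym_flow => x y; rewrite a_sym; ring. Qed.

Lemma lap_sum0 u : \sum_x lap u x = 0.
Proof. by apply: antisym_sum0 => x y; rewrite a_sym; ring. Qed.

(** The diagonal products cancel, and what is left is antisymmetric in the two states: a current, to
    which [antisym_flow] applies. *)
Lemma lap_wronskian f g x :
  f x * lap g x - g x * lap f x = \sum_y a x y * (f x * g y - g x * f y).
Proof.
rewrite /lap !mulr_sumr -sumrB; apply: eq_bigr => y _; ring.
Qed.

Lemma lap_green f g : \sum_x f x * lap g x = \sum_x g x * lap f x.
Proof.
apply/eqP; rewrite -subr_eq0 -sumrB.
under eq_bigr => x _ do rewrite lap_wronskian.
by apply/eqP; apply: antisym_sum0 => x y; rewrite a_sym; ring.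
Qed.

Lemma lapB u v x : lap (fun y => u y - v y) x = lap u x - lap v x.
Proof. by rewrite /lap -sumrB; apply: eq_bigr => y _; ring. Qed.

Lemma lapD u v x : lap (fun y => u y + v y) x = lap u x + lap v x.
Proof. by rewrite /lap -big_split; apply: eq_bigr => y _ /=; ring. Qed.

Lemma lapN u x : lap (fun y => - u y) x = - lap u x.
Proof. by rewrite /lap -sumrN; apply: eq_bigr => y _; ring. Qed.

Lemma lap_zero u x : u x = 0 -> lap u x = \sum_y a x y * u y.
Proof. by move=> ux; apply: eq_bigr => y _; rewrite ux subr0. Qed.

Lemma lap_ge0_zero u x : (forall y, 0 <= u y) -> u x = 0 -> 0 <= lap u x.
Proof. by move=> u0 ux; rewrite lap_zero //; apply: sumr_ge0 => y _; rewrite mulr_ge0. Qed.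

(** At a positive maximum every term of the Laplacian is nonpositive while their sum is nonnegative,
    so all neighbours share the maximum. Connectedness carries it to [z0], where [u] is
    nonpositive. *)
Lemma max_principle (Z : pred S) (u : S -> R) (z0 : S) : z0 \in Z ->
  (forall x, x \notin Z -> 0 <= lap u x) -> (forall x, x \in Z -> u x <= 0) ->
  forall x, u x <= 0.
Proof.
move=> z0Z sub bdry x.
have [m _ mmax] := Order.TotalTheory.arg_maxP u (erefl : xpredT z0).
apply: le_trans (mmax x isT) _; rewrite leNgt; apply/negP => um.
have step y z : u y = u m -> 0 < a y z -> u z = u m.
  move=> uy ayz.
  have yZ : y \notin Z by apply/negP => /bdry; rewrite uy leNgt um.
  have tle t : a y t * (u t - u y) <= 0.
    by rewrite mulr_ge0_le0 // uy subr_le0; apply: mmax.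
  have := sub _ yZ; rewrite /lap (bigD1 z) //= => h.
  have h2 : \sum_(i | i != z) a y i * (u i - u y) <= 0 by apply: sumr_le0.
  have h3 : 0 <= a y z * (u z - u y) by move: (tle z) h h2; lra.
  rewrite pmulr_rge0 // uy subr_ge0 in h3.
  by apply/eqP; rewrite eq_le h3 andbT; apply: mmax.
have /connectP[p pp ez] := a_connected m z0.
have : u z0 = u m.
  have h q w : u w = u m -> path (fun x y => 0 < a x y) w q -> u (last w q) = u m.
    elim: q w => //= y q IH w uw /andP[ay pq].
    by apply: IH => //; apply: step ay.
  by rewrite ez; apply: h.
by move=> e; have := bdry _ z0Z; rewrite e leNgt um.
Qed.

Lemma min_principle (Z : pred S) (u : S -> R) (z0 : S) : z0 \in Z ->
  (forall x, x \notin Z -> lap u x <= 0) -> (forall x, x \in Z -> 0 <= u x) ->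
  forall x, 0 <= u x.
Proof.
move=> z0Z sup bdry x; rewrite -oppr_le0.
apply: (@max_principle Z (fun y => - u y) z0) => // y yZ; last by rewrite oppr_le0 bdry.
by rewrite lapN oppr_ge0 sup.
Qed.

(** The Dirichlet problem is a square linear system, so existence follows from uniqueness, which is
    the maximum principle. *)
Lemma harmonic_extension (Z : pred S) (b : S -> R) (z0 : S) : z0 \in Z ->
  exists2 u : S -> R, forall x, x \in Z -> u x = b x &
    forall x, x \notin Z -> lap u x = 0.
Proof.
move=> z0Z.
pose ev (i : 'I_#|S|) : S := enum_val i.
(* Row vectors act from the left, so column [i] carries the equation at [ev i]: a boundary value on
   [Z], the Laplacian elsewhere. *)
pose M : 'M[R]_#|S| := \matrix_(j, i)
  if ev i \in Z then (j == i)%:R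
  else a (ev i) (ev j) - (j == i)%:R * \sum_y a (ev i) y.
pose fn (v : 'rV[R]_#|S|) (x : S) := v 0 (enum_rank x).
have fnM v x : (v *m M) 0 (enum_rank x) = if x \in Z then fn v x else lap (fn v) x.
  rewrite mxE; under eq_bigr => j _ do rewrite mxE /ev enum_rankK.
  case: ifP => xZ.
    rewrite (bigD1 (enum_rank x)) //= eqxx mulr1 big1 ?addr0 // => j jx.
    by rewrite (negbTE jx) mulr0.
  under eq_bigr => j _ do rewrite mulrBr.
  rewrite sumrB [X in _ - X](bigD1 (enum_rank x)) //= eqxx mul1r.
  rewrite [X in _ - (_ + X)]big1 ?addr0; last by move=> j /negbTE ->; rewrite mul0r mulr0.
  rewrite /lap mulr_sumr; under [RHS]eq_bigr => y _ do rewrite mulrBr.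
  rewrite sumrB; congr (_ - _); last by apply: eq_bigr => y _; rewrite mulrC.
  rewrite (reindex (@enum_rank S)) /=; last exact: onW_bij (enum_rank_bij _).
  by apply: eq_bigr => y _; rewrite enum_rankK mulrC.
have Mu : M \in unitmx.
  rewrite -row_free_unit; apply: inj_row_free => v vM.
  have h x : (if x \in Z then fn v x else lap (fn v) x) = 0 by rewrite -fnM vM mxE.
  have hZ x : x \in Z -> fn v x = 0 by move=> xZ; have := h x; rewrite xZ.
  have hL x : x \notin Z -> lap (fn v) x = 0.
    by move=> /negbTE xZ; have := h x; rewrite xZ.
  apply/rowP => i; rewrite mxE -[i]enum_valK -/(fn v (enum_val i)); apply/eqP.
  rewrite eq_le (@max_principle Z (fn v) z0) ?(@min_principle Z (fn v) z0) //;
    by move=> x xZ; rewrite ?hZ ?hL.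

pose w := (\row_i (if ev i \in Z then b (ev i) else 0)) *m invmx M.
have wM x : (w *m M) 0 (enum_rank x) = if x \in Z then b x else 0.
  by rewrite /w mulmxKV // mxE /ev enum_rankK.
exists (fn w) => x xZ; first by have := wM x; rewrite fnM xZ.
by have := wM x; rewrite fnM (negbTE xZ).
Qed.

Lemma harmonic_01 (Z : pred S) (u : S -> R) (z0 : S) : z0 \in Z ->
  (forall x, x \notin Z -> lap u x = 0) -> (forall x, x \in Z -> 0 <= u x <= 1) ->
  forall x, 0 <= u x <= 1.
Proof.
move=> z0Z har bdry x; apply/andP; split.
  apply: (min_principle z0Z) => y yZ; first by rewrite har.
  by case/andP: (bdry y yZ).
rewrite -subr_le0; apply: (@max_principle Z (fun y => u y - 1) z0) => // y yZ.
  have -> : lap (fun y => u y - 1) y = lap u y by apply: eq_bigr => t _; ring.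
  by rewrite har.
by rewrite subr_le0; case/andP: (bdry y yZ).
Qed.

(** The current leaving [z] crosses the boundary of [A], which has at most [#|S| ^ 2] edges, each
    carrying at most [e] because [u] varies by at most 1. *)
Lemma cap_upper (u : S -> R) (z : S) (A : pred S) (e : R) :
  (forall x, 0 <= u x <= 1) -> z \in A ->
  (forall x, x \in A -> x != z -> lap u x = 0) ->
  (forall x y, x \in A -> y \notin A -> a x y <= e) -> 0 <= e ->
  - lap u z <= #|S|%:R ^+ 2 * e.
Proof.
move=> u01 zA har cut e0.
have -> : lap u z = \sum_(x in A) lap u x.
  by rewrite (bigD1 z) //= big1 ?addr0 // => x /andP[]; apply: har.
rewrite lap_flow -sumrN.
apply: (@le_trans _ _ (\sum_(x in A) #|S|%:R * e)); last first.
  rewrite sumr_const -[leLHS]mulr_natl expr2 -mulrA ler_wpM2r ?mulr_ge0 //.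
  by rewrite ler_nat max_card.
apply: ler_sum => x xA; rewrite -sumrN.
apply: (@le_trans _ _ (\sum_(y | y \notin A) e)); last first.
  rewrite sumr_const -[leLHS]mulr_natl ler_wpM2r // ler_nat.
  exact: max_card.
apply: ler_sum => y yA; rewrite -mulrN opprB.
have /andP[ux0 ux1] := u01 x; have /andP[uy0 uy1] := u01 y.
have := cut x y xA yA; have := a_ge0 x y; nra.
Qed.

(** A path without repetition has fewer than [#|S|] edges, so they cannot all rise by less than
    [1 / #|S|]. *)
Lemma path_drop (r : rel S) (phi : S -> R) (x y : S) :
  connect r x y -> 1 <= phi y - phi x ->
  exists x' y', [/\ r x' y', x' \in connect r x &
    1 <= #|S|%:R * (phi y' - phi x')].
Proof.
move=> /connectP[p0 pp0 ->]; have [p pp up _] := shortenP pp0 => drop.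
have n0 : (0 : R) < #|S|%:R by rewrite ltr0n; apply/card_gt0P; exists x.
have [/existsP[[x' y'] /and3P[/= h1 h2 h3]]|/existsPn nex] :=
  boolP [exists t : S * S, [&& r t.1 t.2, t.1 \in connect r x &
    1 <= #|S|%:R * (phi t.2 - phi t.1)]]; first by exists x', y'.
have slope q w : w \in connect r x -> path r w q ->
    #|S|%:R * (phi (last w q) - phi w) <= (size q)%:R.
  elim: q w => [|t q IH] w cw /=; first by rewrite subrr mulr0.
  move=> /andP[rwt pq].
  have ct : t \in connect r x by apply: connect_trans cw _; apply: connect1.
  have := nex (w, t); rewrite /= rwt cw /= -ltNge => h.
  have := IH t ct pq; rewrite -[in X in _ -> X]natr1; lra.
have := slope p x (connect0 _ _) pp.
have : ((size p)%:R : R) < #|S|%:R.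
  by rewrite ltr_nat; apply: leq_trans (_ : size (x :: p) <= _)%N => //;
     rewrite -(card_uniqP up) max_card.
nra.
Qed.


(** An edge of the path along which [u] drops by [1 / #|S|] leaves the superlevel set [A] of its
    upper end. All currents across the boundary of [A] have the same sign, so this edge alone gives
    a lower bound. [A] lies in the region where [u] is positive, so [z] is its only source. *)
Lemma cap_lower (u : S -> R) (z w : S) (r : rel S) (e : R) :
  (forall x, 0 <= u x <= 1) -> u z = 1 -> u w = 0 ->
  (forall x, x != z -> 0 < u x -> lap u x = 0) ->
  connect r z w -> (forall x y, r x y -> e <= a x y) ->
  e <= #|S|%:R * (- lap u z).
Proof.
move=> u01 uz uw har czw re.
have drop : 1 <= (fun x => - u x) w - (fun x => - u x) z by rewrite uz uw; lra.
have [x [y [rxy _ dxy]]] := @path_drop r (fun x => - u x) z w czw drop.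
have n0 : (0 : R) <= #|S|%:R by rewrite ler0n.
have /andP[uy0 _] := u01 y.
have uxy : u y < u x by rewrite ltNge; apply/negP => h; move: dxy; nra.
pose A : pred S := fun t => u x <= u t.
have zA : z \in A by rewrite unfold_in uz; case/andP: (u01 x).
have flow : lap u z = \sum_(t in A) lap u t.
  rewrite (bigD1 z) //= big1 ?addr0 // => t /andP[tA tz].
  by apply: har => //; apply: lt_le_trans tA; apply: le_lt_trans uxy.
have xA : x \in A by rewrite unfold_in.
have yA : y \notin A by rewrite unfold_in -ltNge.
have term t s : t \in A -> s \notin A -> a t s * (u s - u t) <= 0.
  rewrite !unfold_in -ltNge => h1 h2.
  by rewrite mulr_ge0_le0 // subr_le0 ltW // (lt_le_trans h2).
have : lap u z <= a x y * (u y - u x).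
  rewrite flow lap_flow (bigD1 x) //= (bigD1 y) //= -addrA gerDl.
  rewrite -[leRHS]addr0; apply: lerD; first by apply: sumr_le0 => s /andP[sA _]; apply: term.
  apply: sumr_le0 => t /andP[tA _]; apply: sumr_le0 => s sA; exact: term.
have := re _ _ rxy; have := a_ge0 x y; nra.
Qed.

(* The flow a x y * (g' x * g y - g x * g' y) is conserved away from z1 and z2 and has
   a constant sign across level sets of g' / (g + g'), which jumps by at least
   1 / #|S| on some edge of the path. *)
Lemma flow_lower (g g' : S -> R) (z1 z2 : S) (r : rel S) (c e : R) :
  (forall x, 0 <= g x) -> (forall x, 0 <= g' x) ->
  g z1 = 1 -> g' z1 = 0 -> g z2 = 0 -> g' z2 = 1 ->
  (forall x, x != z1 -> x != z2 -> g x * lap g' x = g' x * lap g x) ->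
  0 < c -> 0 <= e -> connect r z1 z2 ->
  (forall x y, r x y -> [/\ e <= a x y, c <= g x + g' x & c <= g y + g' y]) ->
  c ^+ 2 * e <= #|S|%:R * lap g z2.
Proof.
move=> g0 g'0 g1 g'1 g2 g'2 har c0 e0 czz rP.
pose phi x := g' x / (g x + g' x).
have drop : 1 <= phi z2 - phi z1.
  by rewrite /phi g1 g'1 g2 g'2 add0r addr0 divr1 mul0r subr0.
have [x [y [rxy _ dxy]]] := @path_drop r phi z1 z2 czz drop.
have [ea cx cy] := rP _ _ rxy.
have n0 : (0 : R) <= #|S|%:R by rewrite ler0n.
have fx0 : 0 < g x + g' x by lra.
have fy0 : 0 < g y + g' y by lra.
have cross : (g x + g' x) * (g y + g' y) <= #|S|%:R * (g' y * g x - g y * g' x).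
  have -> : g' y * g x - g y * g' x =
      (phi y - phi x) * ((g x + g' x) * (g y + g' y)).
    by rewrite /phi; field; rewrite ?gt_eqF.
  by rewrite mulrA -[leLHS]mul1r ler_wpM2r // mulr_ge0 // ltW.
have cross0 : 0 < g' y * g x - g y * g' x.
  rewrite ltNge; apply/negP => h.
  have := mulr_gt0 fx0 fy0; move: cross h; nra.
have gx0 : 0 < g x.
  rewrite lt_neqAle g0 andbT eq_sym; apply/eqP => gx.
  by move: cross0; rewrite gx; have := g0 y; have := g'0 x; nra.
(* This is the set where [phi] exceeds [phi x], written without division because [g + g'] may
   vanish; the states where it vanishes are outside [B]. *)
pose B : pred S := fun t => g' x * g t < g' t * g x.
have z2B : z2 \in B by rewrite unfold_in g2 g'2 mulr0 mul1r.
have z1B : z1 \notin B by rewrite unfold_in g1 g'1 mul0r mulr1 -leNgt.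
have zz : z1 != z2 by apply/eqP => ez; move: z1B; rewrite ez z2B.
have flow : - lap g z2 = \sum_(t in B) (g t * lap g' t - g' t * lap g t).
  rewrite (bigD1 z2) //= big1 ?addr0; last first.
    move=> t /andP[tB tz]; rewrite har ?subrr //.
    by apply/eqP => et; move: z1B; rewrite -et tB.
  by rewrite g2 g'2 mul0r mul1r sub0r.
have yB : y \in B by rewrite unfold_in -subr_gt0; move: cross0; nra.
have xB : x \notin B by rewrite unfold_in -leNgt.
have term t s : t \in B -> s \notin B -> a t s * (g t * g' s - g' t * g s) <= 0.
  rewrite !unfold_in -leNgt => h1 h2.
  (* Three-term Plücker relation: multiplied by [g x > 0], the cross product of [t] and [s] is minus
     a nonnegative combination of the comparisons of [t] and of [s] with [x]. *)
  rewrite mulr_ge0_le0 // -(pmulr_rle0 _ gx0).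
  have k1 : 0 <= g t * (g' x * g s - g' s * g x) by rewrite mulr_ge0 // subr_ge0.
  have k2 : 0 <= g s * (g' t * g x - g' x * g t).
    by rewrite mulr_ge0 // subr_ge0 ltW.
  by move: k1 k2; lra.
have le1 : - lap g z2 <= a y x * (g y * g' x - g' y * g x).
  rewrite flow; under eq_bigr => t _ do rewrite lap_wronskian.
  rewrite antisym_flow; last by move=> t s; rewrite a_sym; ring.
  rewrite (bigD1 y) //= (bigD1 x) //= -addrA gerDl.
  rewrite -[leRHS]addr0; apply: lerD; first by apply: sumr_le0 => s /andP[sB _]; apply: term.
  apply: sumr_le0 => t /andP[tB _]; apply: sumr_le0 => s sB; exact: term.
have cc : c ^+ 2 <= #|S|%:R * (g' y * g x - g y * g' x).
  by apply: le_trans cross; nra.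
have le2 : a x y * (g' y * g x - g y * g' x) <= lap g z2.
  by move: le1; rewrite a_sym; lra.
have le3 : e * (g' y * g x - g y * g' x) <= lap g z2.
  by apply: le_trans le2; rewrite ler_wpM2r // ltW.
have := ler_wpM2l n0 le3; have := ler_wpM2r e0 cc; lra.
Qed.

(* Started from s, the chain is killed in B; each killing edge is either dominated by
   the edges to W, or of weight at most kap, negligible with respect to the weight e
   of the path from s to W. *)
Lemma descent_lower (W B : pred S) (f : S -> R) (s w : S) (r : rel S) (c e kap : R) :
  (forall x, 0 <= f x) -> (forall x, x \notin W -> x \notin B -> lap f x = 0) ->
  (forall x, x \in B -> f x = 0) -> 0 <= c -> (forall x, x \in W -> c <= f x) ->
  s \notin W -> s \notin B -> w \in W ->
  connect r s w -> (forall x y, r x y -> e <= a x y) -> 0 <= kap ->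
  (forall y b, y \notin W -> y \notin B -> b \in B ->
     a y b <= \sum_(x in W) a y x + kap) ->
  (forall b, b \in W -> b \notin B) ->
  2 * #|S|%:R ^+ 3 * kap <= e -> 0 < e ->
  c <= 2 * (#|S|%:R + 1) * f s.
Proof.
move=> f0 har fB c0 fW sW sB wW csw re kap0 kill WB ke e0.
pose Z : pred S := fun x => [|| x == s, x \in W | x \in B].
have sZ : s \in Z by rewrite unfold_in eqxx.
(* [k] is the voltage with [s] at 1 and both [W] and [B] grounded; [CW] and [CB] below are the
   currents that enter these two sets. *)
have [k kZ khar] := harmonic_extension (fun x => (x == s)%:R) sZ.
have k01 : forall x, 0 <= k x <= 1.
  apply: (harmonic_01 sZ khar) => x xZ; rewrite kZ //.
  by case: (x == s); rewrite ?lexx ?ler01.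
have k0 x : 0 <= k x by case/andP: (k01 x).
have ks : k s = 1 by rewrite kZ // eqxx.
have kW x : x \in W -> k x = 0.
  move=> xW; rewrite kZ; last by rewrite unfold_in xW orbT.
  by case: eqP => // ex; move: sW; rewrite -ex xW.
have kB x : x \in B -> k x = 0.
  move=> xB; rewrite kZ; last by rewrite unfold_in xB !orbT.
  by case: eqP => // ex; move: sB; rewrite -ex xB.
pose CW := \sum_(x in W) lap k x.
pose CB := \sum_(x in B) lap k x.
have split3 (F : S -> R) : (forall x, x \notin Z -> F x = 0) ->
    \sum_x F x = F s + \sum_(x in W) F x + \sum_(x in B) F x.
  move=> FZ; rewrite (bigD1 s) //= -addrA; congr (_ + _).
  rewrite (bigID (mem W)) /=; congr (_ + _).
    apply: eq_bigl => x; case: (boolP (x \in W)); rewrite ?andbF //= andbT => xW.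
    by apply/eqP => ex; move: sW; rewrite -ex xW.
  rewrite (bigID (mem B)) /= [X in _ + X]big1 ?addr0; last first.
    move=> x /andP[/andP[xs xW] xB]; apply: FZ.
    by rewrite unfold_in negb_or xs negb_or xW.
  apply: eq_bigl => x; case: (boolP (x \in B)); rewrite ?andbF //= andbT => xB.
  apply/andP; split; first by apply/eqP => ex; move: sB; rewrite -ex xB.
  by apply/negP => /WB; rewrite xB.
have tot : - lap k s = CW + CB.
  have := split3 (lap k) khar; rewrite lap_sum0 /CW /CB; lra.
have low : e <= #|S|%:R * (CW + CB).
  rewrite -tot; apply: (cap_lower k01 ks (kW _ wW) _ csw re) => x xs kx.
  apply: khar; apply/negP => /or3P[xs'|xW|xB]; first by rewrite xs' in xs.
    by rewrite kW ?ltxx in kx.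
  by rewrite kB ?ltxx in kx.
(* Green's formula between [f] and [k]: [f s] is at least [c] times [CW / (CW + CB)], the
   probability of reaching [W] before [B]. *)
have green : c * CW <= f s * (CW + CB).
  have gsum : \sum_x k x * lap f x = 0.
    apply: big1 => x _; case: (boolP (x \in W)) => [/kW ->|xW]; first by rewrite mul0r.
    case: (boolP (x \in B)) => [/kB ->|xB]; first by rewrite mul0r.
    by rewrite har // mulr0.
  have := split3 (fun x => f x * lap k x) (fun x h => etrans (congr1 _ (khar x h)) (mulr0 _)).
  rewrite lap_green gsum [X in _ + X]big1 ?addr0; last by move=> x /fB ->; rewrite mul0r.
  have : c * CW <= \sum_(x in W) f x * lap k x.
    rewrite mulr_sumr; apply: ler_sum => x xW; rewrite ler_wpM2r ?fW //.
    by apply: lap_ge0_zero => //; apply: kW.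
  move: tot; nra.
have n0 : (0 : R) <= #|S|%:R by rewrite ler0n.
(* The inequality [kill], weighted by [k y] and summed over [y] and over the killing states. *)
have CBle : CB <= #|S|%:R * CW + #|S|%:R ^+ 2 * kap.
  have -> : CB = \sum_(b in B) \sum_y k y * a y b.
    apply: eq_bigr => b bB; rewrite lap_zero ?kB //.
    by apply: eq_bigr => y _; rewrite a_sym mulrC.
  have CWE : CW = \sum_y k y * \sum_(x in W) a y x.
    under [RHS]eq_bigr => y _ do rewrite mulr_sumr.
    rewrite exchange_big; apply: eq_bigr => x xW; rewrite lap_zero ?kW //.
    by apply: eq_bigr => y _; rewrite a_sym mulrC.
  have CW0 : 0 <= CW.
    by apply: sumr_ge0 => x xW; apply: lap_ge0_zero => //; apply: kW.
  apply: (@le_trans _ _ (\sum_(b in B) (CW + #|S|%:R * kap))); last first.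
    rewrite sumr_const -[leLHS]mulr_natl expr2 -mulrA -mulrDr ler_wpM2r //.
      by rewrite addr_ge0 // mulr_ge0.
    by rewrite ler_nat max_card.
  apply: ler_sum => b bB.
  apply: (@le_trans _ _ (\sum_y (k y * (\sum_(x in W) a y x) + kap))); last first.
    by rewrite big_split /= -CWE sumr_const mulr_natl.
  apply: ler_sum => y _.
  case: (boolP (y \in W)) => [/kW ->|yW]; first by rewrite !mul0r add0r.
  case: (boolP (y \in B)) => [/kB ->|yB]; first by rewrite !mul0r add0r.
  have := ler_wpM2l (k0 y) (kill y b yW yB bB).
  by case/andP: (k01 y) => _ ky1; nra.
have CWCB : 0 < CW + CB.
  rewrite ltNge; apply/negP => h.
  by have := mulr_ge0_le0 n0 h; move: low; lra.
have n1 : (1 : R) <= #|S|%:R by rewrite ler1n; apply/card_gt0P; exists s.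
(* The total current is at least [e / #|S|], so the error term of [CBle] is at most half of it and
   can be absorbed. This is the origin of the constant [2 * #|S| ^ 3] in the comparison of [kap]
   with [e]. *)
have half : 2 * (#|S|%:R ^+ 2 * kap) <= CW + CB.
  have n1' : (0 : R) < #|S|%:R by lra.
  rewrite -(ler_pM2l n1'); apply: le_trans low; apply: le_trans ke.
  by rewrite !exprS expr0; lra.
have half2 : CW + CB <= 2 * (#|S|%:R + 1) * CW by lra.
have CW0 : 0 < CW.
  rewrite ltNge; apply/negP => h.
  have : 2 * (#|S|%:R + 1) * CW <= 0 by rewrite mulr_ge0_le0 // mulr_ge0; lra.
  lra.
rewrite -(ler_pM2r CW0); apply: le_trans green _.
by have := ler_wpM2l (f0 s) half2; lra.
Qed.

End Network.

(** * Survival of a finite Markov chain *)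

Lemma derive_left_min (R : realType) (f : R -> R) (t0 D : R) : 0 < t0 ->
  is_derive t0 (1 : R) f D -> (forall t, 0 <= t <= t0 -> f t0 <= f t) -> D <= 0.
Proof.
move=> t00 [df <-] fmin.
have /cvg_dnbhs_at_left cv : h^-1 *: (f (h *: 1 + t0) - f t0) @[h --> 0^'] -->
    'D_1 f t0 by exact: df.
apply: (cvgr_to_le cv); near=> h.
have h0 : h < 0 by near: h; apply: nbhs_left_lt.
have h1 : - t0 <= h by near: h; apply: nbhs_left_ge; lra.
rewrite /= [_ *: _ in X in f X]mulr1.
have : f t0 <= f (h + t0) by apply: fmin; lra.
move=> hf; apply: mulr_le0_ge0; first by rewrite invr_le0 ltW.
by rewrite subr_ge0.
Unshelve. all: by end_near. Qed.

(* At a negative minimum of exp (- C t) z over [0, T] x S, with C larger than the row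
   sums of Q, the derivative in t would be positive. *)
Lemma ode_nonneg (R : realType) (S : finType) (Q : S -> S -> R)
    (r z : R -> S -> R) :
  (forall x y, x != y -> 0 <= Q x y) -> (forall x, 0 <= z 0 x) ->
  (forall t x, 0 <= t -> 0 <= r t x) ->
  (forall t x, is_derive t (1 : R) (fun u => z u x)
     (\sum_y Q x y * z t y + r t x)) ->
  forall t x, 0 <= t -> 0 <= z t x.
Proof.
move=> Q0 z0 r0 dz T x1 T0.
(* The summand 1 makes [C] strictly larger than each row sum, hence the derivative at a negative
   minimum strictly positive. *)
pose C : R := 1 + \sum_x \sum_y `|Q x y|.
have rowC x : \sum_y Q x y < C.
  have h1 : \sum_y Q x y <= \sum_y `|Q x y| by apply: ler_sum => y _; exact: ler_norm.
  have h2 : \sum_y `|Q x y| <= \sum_x \sum_y `|Q x y|.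
    by rewrite [leRHS](bigD1 x) //= lerDl; apply: sumr_ge0 => y _; apply: sumr_ge0.
  by rewrite /C; lra.
pose e t : R := expR (- C * t).
have de t : is_derive t (1 : R) e (- C * e t).
  have : is_derive t (1 : R) (expR \o ( *%R (- C))) (expR (- C * t) * (- C)).
    apply: is_derive1_comp.
    have : is_derive t (1 : R) (- C \*: id) (- C *: 1) by apply: is_deriveZ.
    by rewrite [_ *: _]mulr1.
  by move=> h; apply: is_derive_eq h _; rewrite mulrC.
pose m x t := e t * z t x.
have dm x t : is_derive t (1 : R) (m x)
    (e t * (\sum_y Q x y * z t y + r t x) - C * m x t).
  have h := is_deriveM (de t) (dz t x).
  apply: is_derive_eq h _; rewrite /m /GRing.scale /=; ring.
have cm x : {within `[0, T], continuous (m x)}.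
  by apply: derivable_within_continuous => t _; case: (dm x t).
have [c cT cmin] := fin_all_exists2 (fun x => EVT_min T0 (cm x)).
have [x0 _ x0min] := Order.TotalTheory.arg_minP (fun x => m x (c x)) (erefl : xpredT x1).
have e0 t : 0 < e t by exact: expR_gt0.
suff m0 : 0 <= m x0 (c x0).
  have : 0 <= m x1 T.
    apply: le_trans m0 _; apply: le_trans (x0min x1 isT) _; apply: cmin.
    by rewrite in_itv /= T0 lexx.
  by rewrite /m pmulr_rge0.
rewrite leNgt; apply/negP => m0.
set t0 := c x0 in m0.
have /andP[t0ge t0T] : 0 <= t0 <= T by have := cT x0; rewrite in_itv.
have t0gt : 0 < t0.
  rewrite lt_neqAle t0ge andbT; apply/eqP => h0.
  by move: m0; rewrite /m -h0 ltNge mulr_ge0 // ltW.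
have mmin y : m x0 t0 <= m y t0.
  apply: le_trans (x0min y isT) _; apply: cmin.
  by rewrite in_itv /= t0ge t0T.
have := derive_left_min t0gt (dm x0 t0).
(* Regrouping around the minimal value makes the diagonal entry of [Q], whose sign is not known,
   multiply zero. *)
have -> : e t0 * (\sum_y Q x0 y * z t0 y + r t0 x0) - C * m x0 t0 =
    \sum_y Q x0 y * (m y t0 - m x0 t0) + (\sum_y Q x0 y - C) * m x0 t0
      + e t0 * r t0 x0.
  rewrite mulrDr mulr_sumr mulrBl mulr_suml.
  have -> : \sum_y Q x0 y * (m y t0 - m x0 t0) =
     \sum_y e t0 * (Q x0 y * z t0 y) - \sum_y Q x0 y * m x0 t0.
    by rewrite -sumrB; apply: eq_bigr => y _; rewrite /m; ring.
  ring.
move=> H; have : 0 < \sum_y Q x0 y * (m y t0 - m x0 t0)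
    + (\sum_y Q x0 y - C) * m x0 t0 + e t0 * r t0 x0.
  have h1 : 0 <= \sum_y Q x0 y * (m y t0 - m x0 t0).
    apply: sumr_ge0 => y _; have [<-|xy] := eqVneq x0 y; first by rewrite subrr mulr0.
    by rewrite mulr_ge0 ?Q0 // subr_ge0.
  have h2 : 0 < (\sum_y Q x0 y - C) * m x0 t0.
    by rewrite nmulr_rgt0 // subr_lt0.
  have h3 : 0 <= e t0 * r t0 x0 by rewrite mulr_ge0 // ?r0 // ltW.
  lra.
rewrite ltNge H // => t /andP[t1 t2]; apply: cmin.
by rewrite in_itv /= t1 (le_trans t2).
Qed.

Section Transition.
Variables (R : realType) (S : finType) (c : S -> S -> R) (p : R -> S -> S -> R).
Hypothesis c_ge0 : forall x y, 0 <= c x y.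
Hypothesis trans_p : is_transition_function c p.

Lemma generator_ge0 x y : x != y -> 0 <= generator c x y.
Proof. by rewrite /generator => /negbTE ->. Qed.

Lemma transition_ge0 t x y : 0 <= t -> 0 <= p t x y.
Proof.
case: trans_p => p0 dp.
apply: (@ode_nonneg _ _ (generator c) (fun _ _ => 0) (fun t x => p t x y)) => //.
- exact: generator_ge0.
- by move=> z; rewrite p0 ler0n.
- by move=> u z; rewrite addr0.
Qed.

Lemma is_derive_finsum (F : S -> R -> R) (dF : S -> R) (t : R) :
  (forall y, is_derive t (1 : R) (F y) (dF y)) ->
  is_derive t (1 : R) (fun u => \sum_y F y u) (\sum_y dF y).
Proof.
move=> dFP.
have -> : (fun u => \sum_y F y u) = \sum_y F y.
  by apply/funext => u; rewrite fct_sumE.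
by elim/big_ind2 : _ => // [|] *; [exact: is_derive_cst|exact: is_deriveD].
Qed.

(** The difference of the two sides vanishes at time 0 and solves the backward equation with source
    [e t * (L v + eps v)], nonnegative by hypothesis; [ode_nonneg] concludes. *)
Lemma transition_subinvariant (v : S -> R) (eps : R) :
  (forall x, - (eps * v x) <= \sum_y generator c x y * v y) ->
  forall t x, 0 <= t -> expR (- (eps * t)) * v x <= \sum_y p t x y * v y.
Proof.
move=> sub t x t0; rewrite -subr_ge0.
case: trans_p => p0 dp.
pose e (t : R) : R := expR (- eps * t).
have de s : is_derive s (1 : R) e (- eps * e s).
  have : is_derive s (1 : R) (expR \o ( *%R (- eps))) (expR (- eps * s) * (- eps)).
    apply: is_derive1_comp.
    have : is_derive s (1 : R) (- eps \*: id) (- eps *: 1) by apply: is_deriveZ.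
    by rewrite [_ *: _]mulr1.
  by move=> h; apply: is_derive_eq h _; rewrite mulrC.
rewrite -[- (eps * t)]mulNr -/(e t).
apply: (@ode_nonneg _ _ (generator c)
  (fun t x => e t * (\sum_y generator c x y * v y + eps * v x))
  (fun t x => \sum_y p t x y * v y - e t * v x)) => //.
- exact: generator_ge0.
- move=> y; rewrite /e mulr0 expR0 mul1r.
  under eq_bigr => z _ do rewrite p0.
  rewrite (bigD1 y) //= eqxx mul1r big1 ?addr0 ?subrr // => z zy.
  by rewrite eq_sym (negbTE zy) mul0r.
- move=> s y s0; apply: mulr_ge0; first exact: expR_ge0.
  by have := sub y; lra.
- move=> s y.
  have d1 : is_derive s (1 : R) (fun u => \sum_z p u y z * v z)
      (\sum_z (\sum_w generator c y w * p s w z) * v z).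
    apply: is_derive_finsum => z.
    have h := is_deriveM (dp s y z) (is_derive_cst (v z) s (1 : R)).
    by apply: is_derive_eq h _; rewrite /GRing.scale /=; ring.
  have d2 : is_derive s (1 : R) (fun u => e u * v y) (- eps * e s * v y).
    have h := is_deriveM (de s) (is_derive_cst (v y) s (1 : R)).
    by apply: is_derive_eq h _; rewrite /GRing.scale /=; ring.
  have d3 := is_deriveB d1 d2; apply: is_derive_eq d3 _.
  under [\sum_(y0 : S) _ * (_ - _)]eq_bigr => z _ do rewrite mulrBr.
  rewrite sumrB.
  have -> : \sum_z generator c y z * \sum_w p s z w * v w =
      \sum_z (\sum_w generator c y w * p s w z) * v z.
    under eq_bigr => z _ do rewrite mulr_sumr.
    rewrite exchange_big; apply: eq_bigr => z _; rewrite mulr_suml.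
    by apply: eq_bigr => w _; ring.
  have -> : \sum_z generator c y z * (e s * v z) = e s * \sum_z generator c y z * v z.
    by rewrite mulr_sumr; apply: eq_bigr => w _; ring.
  ring.
Qed.

End Transition.

Lemma measure_disjoint_sum (R : realType) (S : finType) (d : measure_display)
    (Omega : measurableType d) (P : probability Omega R) (F : S -> set Omega)
    (E : set Omega) (D : pred S) :
  (forall y, measurable (F y)) -> trivIset setT F -> measurable E ->
  (forall y, D y -> F y `<=` E) ->
  (\sum_(y | D y) P (F y) <= P E)%E.
Proof.
move=> mF tF mE FE.
have fD : finite_set [set` D] by apply: finite_finset.
have -> : (\sum_(y | D y) P (F y) = P (\bigcup_(y in [set` D]) F y))%E.
  rewrite measure_fin_bigcup //; last exact: sub_trivIset tF.
  rewrite (@fsbig_fwiden _ _ _ _ [seq y <- index_enum S | D y]).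
  - by rewrite big_filter.
  - by move=> y /= yD; rewrite mem_filter mem_index_enum andbT.
  - by rewrite filter_uniq // index_enum_uniq.
  - by move=> y /= []; rewrite mem_filter => /andP[].
apply: le_measure; rewrite ?inE //.
- by apply: fin_bigcup_measurable.
- by move=> w [y yD Fy]; apply: (FE y).
Qed.

Lemma measurable_forall_nat (d : measure_display) (Omega : measurableType d)
    (b : nat -> bool) (A : nat -> set Omega) :
  (forall k, b k -> measurable (A k)) -> measurable [set w | forall k, b k -> A k w].
Proof.
move=> mA.
have -> : [set w | forall k, b k -> A k w] = \bigcap_k [set w | b k -> A k w].
  by apply/seteqP; split=> w h k; [move=> _; apply: h|apply: h].
apply: bigcapT_measurable => k; have [bk|/negP bk] := boolP (b k).
  have -> : [set w | true -> A k w] = A k by apply/seteqP; split=> w h //; apply: h.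
  exact: mA.
have -> : [set w | false -> A k w] = setT by apply/seteqP; split.
exact: measurableT.
Qed.

(** * From a subinvariant function to a lower bound on the expected hitting time *)

Import HBNNSimple.
Section Survival.
Variables (R : realType) (S : finType) (c : S -> S -> R) (x0 z : S).
Variables (d : measure_display) (Omega : measurableType d).
Variables (P : probability Omega R) (X : R -> Omega -> S).
Hypothesis c_ge0 : forall x y, 0 <= c x y.
Hypothesis X_markov : is_markov_chain c x0 P X.
Variables (v : S -> R) (eps : R).
Hypothesis v01 : forall x, 0 <= v x <= 1.
Hypothesis v_z : v z = 0.
Hypothesis eps_gt0 : 0 < eps.
Hypothesis v_sub : forall x, - (eps * v x) <= \sum_y generator c x y * v y.

Let measurable_state t x : 0 <= t -> measurable [set w | X t w = x].
Proof. by case: X_markov => h _ _; apply: h. Qed.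

Let measurable_avoid t : 0 <= t -> measurable [set w | X t w <> z].
Proof. by move=> t0; apply: measurableC; apply: measurable_state. Qed.

(** By the Markov property, each step that must avoid [z] costs a factor [expR (- (eps * dt))] on
    the expectation of [v], and [v <= 1] turns the expectation into a probability at the end. *)
Lemma grid_avoidance (dt : R) (N : nat) : 0 <= dt ->
  ((expR (- (eps * (dt * N%:R))) * v x0)%:E <=
    P [set w | forall k, (k <= N)%N -> X (dt * k%:R) w <> z])%E.
Proof.
move=> dt0; case: X_markov => _ _ [p tp law].
have tk k : 0 <= dt * k%:R by rewrite mulr_ge0.
(* The positions at the first [n + 1] grid times are prescribed and the next [j] must avoid [z]. The
   induction on [j] trades one avoidance for a sum over the next prescribed state. *)
pose E n j (x : nat -> S) := [set w | forall k, (k <= n)%N -> X (dt * k%:R) w = x k]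
  `&` [set w | forall k, (n < k <= n + j)%N -> X (dt * k%:R) w <> z].
have mE n j x : measurable (E n j x).
  by apply: measurableI; apply: measurable_forall_nat => k _;
    [apply: measurable_state|apply: measurable_avoid].
have main j : forall n x, ((((x 0%N == x0)%:R * \prod_(k < n) p dt (x k) (x k.+1)) *
    (expR (- (eps * (dt * j%:R))) * v (x n)))%:E <= P (E n j x))%E.
  elim: j => [|j IH] n x.
    have -> : E n 0%N x = [set w | forall k, (k <= n)%N -> X (dt * k%:R) w = x k].
      apply/seteqP; split=> w; first by case.
      by move=> h; split => // k /andP[h1]; rewrite addn0 leqNgt h1.
    rewrite (law n (fun k => dt * k%:R)) ?mulr0 //; last first.
      by move=> k; rewrite ler_wpM2l // ler_nat.
    have -> : \prod_(k < n) p (dt * k.+1%:R - dt * k%:R) (x k) (x k.+1) =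
        \prod_(k < n) p dt (x k) (x k.+1).
      by apply: eq_bigr => k _; congr (p _ _ _); rewrite -natr1; ring.
    rewrite lee_fin oppr0 expR0 mul1r -[leRHS]mulr1 ler_wpM2l //.
      by rewrite mulr_ge0 //; apply: prodr_ge0 => k _; apply: (transition_ge0 c_ge0 tp).
    by case/andP: (v01 (x n)).
  pose up y k := if k == n.+1 then y else x k.
  apply: (@le_trans _ _ (\sum_(y | y != z) P (E n.+1 j (up y)))%E); last first.
    apply: (@measure_disjoint_sum _ _ _ _ _ (fun y => E n.+1 j (up y))) => //.
      apply/trivIsetP => y y' _ _ yy'; apply/seteqP; split=> // w [[h1 _] [h2 _]].
      have := h1 n.+1 (leqnn _); rewrite h2 // /up eqxx => e.
      by move: yy'; rewrite e eqxx.
    move=> y yz w [h1 h2]; split=> k hk.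
      by rewrite h1 ?leqW // /up ltn_eqF.
    have [e|ne] := eqVneq k n.+1.
      by rewrite e h1 // /up eqxx; apply/eqP.
    by apply: h2; rewrite addSnnS; case/andP: hk => hk1 ->; rewrite ltn_neqAle eq_sym ne hk1.
  apply: (@le_trans _ _ (\sum_(y | y != z)
     (((x 0%N == x0)%:R * \prod_(k < n) p dt (x k) (x k.+1)) * p dt (x n) y *
    (expR (- (eps * (dt * j%:R))) * v y))%:E)%E); last first.
    apply: lee_sum => y _; apply: le_trans (IH n.+1 (up y)).
    rewrite lee_fin /up /= eqxx big_ord_recr /= eqxx ltn_eqF //.
    have -> : \prod_(k < n) p dt (if k == n.+1 :> nat then y else x k)
        (if k.+1 == n.+1 then y else x k.+1) = \prod_(k < n) p dt (x k) (x k.+1).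
      by apply: eq_bigr => k _; rewrite eqSS !ltn_eqF // ltnS ltnW.
    by rewrite !mulrA.
  rewrite sumEFin lee_fin.
  (* The missing state [z] is added to the sum at no cost, since [v z = 0]. *)
  have -> : \sum_(y | y != z) (x 0%N == x0)%:R * (\prod_(k < n) p dt (x k) (x k.+1)) *
      p dt (x n) y * (expR (- (eps * (dt * j%:R))) * v y) =
    (x 0%N == x0)%:R * (\prod_(k < n) p dt (x k) (x k.+1)) *
      (expR (- (eps * (dt * j%:R))) * \sum_y p dt (x n) y * v y).
    rewrite [\sum_y p dt (x n) y * v y](bigD1 z) //= v_z mulr0 add0r !mulr_sumr.
    by apply: eq_bigr => y _; ring.
  rewrite ler_wpM2l //.
    by rewrite mulr_ge0 //; apply: prodr_ge0 => k _; apply: (transition_ge0 c_ge0 tp).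
  have -> : - (eps * (dt * j.+1%:R)) = - (eps * (dt * j%:R)) + - (eps * dt).
    by rewrite -natr1; ring.
  rewrite expRD -mulrA ler_wpM2l ?expR_ge0 //.
  exact: (transition_subinvariant c_ge0 tp).
have [x0z|x0z] := eqVneq x0 z; first by rewrite x0z v_z mulr0 measure_ge0.
have := main N 0%N (fun=> x0); rewrite eqxx big_ord0 !mul1r => h.
apply: le_trans h _; apply: le_measure; rewrite ?inE //.
  by apply: measurable_forall_nat => k _; apply: measurable_avoid.
move=> w [h1 h2] [_|k kN]; first by rewrite h1 //; apply/eqP.
by apply: h2; rewrite add0n.
Qed.

Lemma hitting_time_ge0 w : (0 <= hitting_time X z w)%E.
Proof. by apply: le_ereal_inf_tmp => _ [t [t0 _] <-]; rewrite lee_fin. Qed.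

(** Markov's inequality at time [T = 1 / eps], which maximises [t * expR (- (eps * t))]. Survival up
    to [T] is the decreasing limit of avoidance along the dyadic grids of [[0, T]]. *)
Lemma expected_hitting_time_ge :
  ((expR (- 1) * v x0 / eps)%:E <= expected_hitting_time P X z)%E.
Proof.
pose T := eps^-1; have T0 : 0 < T by rewrite invr_gt0.
pose G n := [set w | forall k, (k <= 2 ^ n)%N -> X (T / 2 ^+ n * k%:R) w <> z].
have dt0 n : 0 <= T / 2 ^+ n by rewrite mulr_ge0 ?ltW // invr_ge0 exprn_ge0.
have mG n : measurable (G n).
  apply: measurable_forall_nat => k _; apply: measurable_avoid.
  by rewrite mulr_ge0.
have p2 n : (2 ^+ n : R) != 0 by rewrite expf_neq0.
have ndG : nonincreasing_seq G.
  apply/nonincreasing_seqP => n; apply/subsetPset => w h k kn.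
  have := h k.*2; rewrite expnS mul2n leq_double kn => /(_ isT).
  by rewrite -muln2 natrM exprS invfM; have -> : T / 2 ^+ n * k%:R =
      T * (2^-1 / 2 ^+ n) * (k%:R * 2%:R) by field.
have mGI : measurable (\bigcap_n G n) by apply: bigcapT_measurable.
have PG : ((expR (- 1) * v x0)%:E <= P (\bigcap_n G n))%E.
  have cv := nonincreasing_cvg_mu (le_lt_trans (probability_le1 P (mG 0%N)) (ltry 1)) mG mGI ndG.
  rewrite -(cvg_lim _ cv) //; apply: lime_ge; first by apply/cvg_ex; eexists; exact: cv.
  apply: nearW => n /=; have := grid_avoidance (2 ^ n) (dt0 n).
  by rewrite natrX divfK // /T mulfV ?gt_eqF.
(* By right continuity a visit to [z] before [T] lasts for a positive time, hence is seen by a fine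
   enough grid. *)
have GT w : (\bigcap_n G n) w -> (T%:E <= hitting_time X z w)%E.
  move=> Gw; apply: le_ereal_inf_tmp => _ [t [t0 Xt] <-]; rewrite lee_fin leNgt.
  apply/negP => tT.
  have [_ rc _] := X_markov; have := rc w t t0; rewrite Xt.
  rewrite /at_right near_withinE => /nbhs_ballP[eta /= eta0 near_t].
  pose r := Num.min eta (T - t).
  have r0 : 0 < r by rewrite lt_min eta0 subr_gt0.
  have [n nr] : exists n, T / 2 ^+ n < r.
    exists (Num.bound (T / r)); rewrite ltr_pdivrMr ?exprn_gt0 // mulrC -ltr_pdivrMr //.
    exact: upper_nthrootP.
  have D0 : 0 < T / 2 ^+ n by rewrite divr_gt0 // exprn_gt0.
  (* The first grid time strictly after [t]; it is within one mesh of [t] and, as [t < T], still in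
     the grid. *)
  pose k := (Num.truncn (t / (T / 2 ^+ n))).+1.
  have k1 : t < T / 2 ^+ n * k%:R.
    by rewrite mulrC -ltr_pdivrMr //; apply: Num.Theory.truncnS_gt.
  have k2 : T / 2 ^+ n * k%:R <= t + T / 2 ^+ n.
    rewrite /k -[(Num.truncn _).+1%:R]natr1 mulrDr mulr1 lerD2r mulrC -ler_pdivlMr //.
    by rewrite Num.Theory.truncn_le divr_ge0 // ltW.
  have k3 : (k <= 2 ^ n)%N.
    rewrite /k Num.Theory.truncn_lt_nat ?natrX ?ltr_pdivrMr //; first by rewrite mulrC divfK.
    by rewrite divr_ge0 // ltW.
  apply: (Gw n I k k3); apply: near_t; rewrite // /ball /=.
  have : r <= eta by rewrite ge_min lexx.
  by move=> ?; rewrite ltr0_norm; lra.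
rewrite /expected_hitting_time ge0_integralTE; last exact: hitting_time_ge0.
(* The integral is a supremum over the simple functions below the hitting time; [T] times the
   indicator of the survival event is one of them. *)
pose h : {nnsfun Omega >-> R} :=
  scale_nnsfun (indic_nnsfun R mGI) (ltW T0).
apply: (@le_trans _ _ (sintegral P h)); last first.
  apply: ereal_sup_ubound; exists h => // w.
  rewrite /h /= /measurable_realfun.mindic indicE; case: (boolP (w \in \bigcap_n G n)) => wG.
    by rewrite mulr1; apply: GT; rewrite inE in wG.
  by rewrite mulr0; apply: hitting_time_ge0.
have -> : sintegral P h = (T%:E * P (\bigcap_n G n))%E.
  rewrite -(sintegral_indic P (\bigcap_n G n)).
  exact: (sintegralrM P T (indic_nnsfun R mGI)).
rewrite (_ : expR (- 1) * v x0 / eps = T * (expR (- 1) * v x0)); last by rewrite mulrC.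
by rewrite EFinM lee_pmul2l // lte_fin.
Qed.

End Survival.

(** * The Potts Hamiltonian on the torus *)

Lemma val_iter_ordS n i (x : 'I_n) : val (iter i (@ordS n) x) = ((x + i) %% n)%N.
Proof.
elim: i => [|i IH] /=; first by rewrite addn0 modn_small.
by rewrite IH -[in LHS]addn1 modnDml addn1 addnS.
Qed.

Lemma iter_ordS_reach n (x y : 'I_n) : exists i, iter i (@ordS n) x = y.
Proof.
exists (n - x + y)%N; apply: val_inj; rewrite val_iter_ordS.
have xn := ltn_ord x.
by rewrite addnA subnKC 1?ltnW // modnDl modn_small.
Qed.

Lemma iter_ordS_inj n (x : 'I_n) i j : (i < n)%N -> (j < n)%N ->
  iter i (@ordS n) x = iter j (@ordS n) x -> i = j.
Proof.
move=> hi hj /(congr1 val); rewrite !val_iter_ordS => /eqP.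
by rewrite eqn_modDl !modn_small // => /eqP.
Qed.

Lemma ordS_neq n (x : 'I_n) : (1 < n)%N -> ordS x != x.
Proof.
move=> n1; apply/eqP => e.
by have := @iter_ordS_inj n x 1 0 n1 (ltnW n1) e.
Qed.

Lemma ordSS_neq n (x : 'I_n) : (2 < n)%N -> ordS (ordS x) != x.
Proof.
move=> n2; apply/eqP => e.
by have := @iter_ordS_inj n x 2 0 n2 (ltnW (ltnW n2)) e.
Qed.

Section Torus.
Variables K L : nat.
Hypothesis K_gt2 : (2 < K)%N.
Hypothesis L_gt2 : (2 < L)%N.
Notation site := (site K L).
Notation config := (config K L).

Definition east (x : site) : site := (ordS x.1, x.2).
Definition west (x : site) : site := (ord_pred x.1, x.2).
Definition north (x : site) : site := (x.1, ordS x.2).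
Definition south (x : site) : site := (x.1, ord_pred x.2).

Lemma eastK : cancel east west. Proof. by case=> i j; rewrite /east /west /= ordSK. Qed.
Lemma westK : cancel west east. Proof. by case=> i j; rewrite /east /west /= ord_predK. Qed.
Lemma northK : cancel north south. Proof. by case=> i j; rewrite /north /south /= ordSK. Qed.
Lemma southK : cancel south north. Proof. by case=> i j; rewrite /north /south /= ord_predK. Qed.

Lemma east_neq x : east x != x.
Proof. by apply/eqP => /(congr1 fst) /= /eqP; apply/negP/ordS_neq/ltnW. Qed.
Lemma north_neq x : north x != x.
Proof. by apply/eqP => /(congr1 snd) /= /eqP; apply/negP/ordS_neq/ltnW. Qed.

Lemma set2_eqP (T : finType) (x y x' y' : T) : [set x; y]%SET = [set x'; y']%SET ->
  (x = x' /\ y = y') \/ (x = y' /\ y = x').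
Proof.
move=> e.
have hx : x \in [set x'; y']%SET by rewrite -e set21.
have hy : y \in [set x'; y']%SET by rewrite -e set22.
have hx' : x' \in [set x; y]%SET by rewrite e set21.
have hy' : y' \in [set x; y]%SET by rewrite e set22.
move: hx hy hx' hy'; rewrite !inE.
by do 4![case/orP => /eqP ?]; subst; auto.
Qed.

Lemma edgesE : edges K L =
  ([set [set x; east x] | x in [set: site]] :|: [set [set x; north x] | x in [set: site]])%SET.
Proof.
apply/setP => e; rewrite inE; apply/imset2P/orP.
  case=> x y _; rewrite inE => /andP[_]; rewrite /neighbour => xy ->.
  case/orP: xy => /andP[/eqP e1 /orP[] /eqP e2]; [right|right|left|left];
    apply/imsetP; [exists x|exists y|exists x|exists y] => //.
  - by congr [set x; _]%SET; rewrite /north e1 -e2; case: (y).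
  - by rewrite finset.setUC; congr [set y; _]%SET; rewrite /north -e1 -e2; case: (x).
  - by congr [set x; _]%SET; rewrite /east e1 -e2; case: (y).
  - by rewrite finset.setUC; congr [set y; _]%SET; rewrite /east -e1 -e2; case: (x).
case=> /imsetP[x _ ->].
  by exists x (east x); rewrite // !inE /neighbour /= !eqxx /= ?orbT.
by exists x (north x); rewrite // !inE /neighbour /= !eqxx /= ?orbT.
Qed.

Lemma monochromatic2 (s : config) x y : monochromatic s [set x; y]%SET = (s x == s y).
Proof.
apply/forall_inP/idP => [h|/eqP e z].
  by have /forall_inP := h x (set21 _ _); apply; exact: set22.
rewrite !inE => /orP[] /eqP ->; apply/forall_inP => t;
  rewrite !inE => /orP[] /eqP ->; by rewrite ?e eqxx.
Qed.

Variables (R : realType) (h : spin -> R).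
Local Notation H := (hamiltonian (K := K) (L := L) h).

Definition bonds (f : site -> site) (s : config) : R := \sum_x (s x == s (f x))%:R.

(** Sides greater than 2 ensure that each edge is the east or the north edge of exactly one site, so
    sums over sites count every edge once. *)
Lemma hamiltonianE s : H s = - (bonds east s + bonds north s) - \sum_x h (s x).
Proof.
rewrite /hamiltonian; congr (- _ - _); rewrite edgesE.
rewrite (eq_bigl [predU [set [set x; east x] | x in [set: site]]%SET
   & [set [set x; north x] | x in [set: site]]%SET]); last by move=> e; rewrite !inE.
rewrite bigU /=; last first.
  rewrite disjoint_subset; apply/fintype.subsetP => _ /imsetP[x _ ->].
  rewrite inE; apply/imsetP => -[y _] /set2_eqP[] [e1 e2].
    move: e2; rewrite e1 => /(congr1 fst) /= /eqP.
    by apply/negP/ordS_neq/ltnW.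
  move: e2; rewrite e1 => /(congr1 snd) /=/eqP.
  by apply/negP/ordS_neq/ltnW.
rewrite !big_imset /=.
- by rewrite /bonds; congr (_ + _); apply: eq_big => [x|x _]; rewrite ?inE // monochromatic2.
- move=> x y _ _ /set2_eqP[] [e1 e2] //.
  move: e2; rewrite e1 => /(congr1 snd) /= /eqP e2.
  by have := ordSS_neq y.2 L_gt2; rewrite e2.
- move=> x y _ _ /set2_eqP[] [e1 e2] //.
  move: e2; rewrite e1 => /(congr1 fst) /= /eqP e2.
  by have := ordSS_neq y.1 K_gt2; rewrite e2.
Qed.

Definition upd (s : config) (x : site) (c : spin) : config :=
  [ffun z => if z == x then c else s z].

Lemma upd_same s x c : upd s x c x = c. Proof. by rewrite ffunE eqxx. Qed.
Lemma upd_other s x c y : y != x -> upd s x c y = s y.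
Proof. by rewrite ffunE => /negbTE ->. Qed.

Lemma bonds_upd (f g : site -> site) s x c :
  cancel f g -> cancel g f -> (forall y, f y != y) ->
  bonds f (upd s x c) - bonds f s =
   ((s (f x) == c)%:R - (s (f x) == s x)%:R) + ((s (g x) == c)%:R - (s (g x) == s x)%:R).
Proof.
move=> fK gK fN.
have gx : g x != x by apply/eqP => e; have := fN (g x); rewrite gK {1}e eqxx.
rewrite /bonds -sumrB (bigD1 x) //= (bigD1 (g x)) //= gK upd_same !upd_other //.
rewrite big1 ?addr0.
  by congr (_ - _ + (_ - _)); rewrite eq_sym.
move=> y /andP[yx yg]; rewrite !upd_other ?subrr //.
by apply/eqP => e; move: yg; rewrite -e fK eqxx.
Qed.

Definition agree (s : config) (x : site) (c : spin) : nat :=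
  ((s (east x) == c) + (s (west x) == c) + (s (north x) == c) + (s (south x) == c))%N.

Lemma hamiltonian_upd s x c :
  H (upd s x c) = H s + (agree s x (s x))%:R - (agree s x c)%:R - h c + h (s x).
Proof.
have e := bonds_upd s x c eastK westK east_neq.
have n := bonds_upd s x c northK southK north_neq.
have f : \sum_y h (upd s x c y) - \sum_y h (s y) = h c - h (s x).
  rewrite -sumrB (bigD1 x) //= upd_same big1 ?addr0 // => y yx.
  by rewrite upd_other // subrr.
rewrite !hamiltonianE /agree !natrD; move: e n f.
set a1 := bonds _ _; set a2 := bonds _ _; set a3 := bonds _ _; set a4 := bonds _ _.
set a5 := \sum_y _; set a6 := \sum_y _; lra.
Qed.

Definition adjacent (s t : config) := #|[set x | s x != t x]%SET| == 1%N.

Lemma adjacent_sym (s t : config) : adjacent s t = adjacent t s.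
Proof. by congr (_ == _); apply: eq_card => x; rewrite !inE eq_sym. Qed.

Lemma adjacentP (s t : config) : reflect (exists x c, c != s x /\ t = upd s x c) (adjacent s t).
Proof.
apply: (iffP cards1P) => [[x ex]|[x [c [cx ->]]]].
  exists x, (t x); split.
    by have := finset.set11 x; rewrite -ex inE eq_sym.
  apply/ffunP => y; rewrite ffunE; case: eqVneq => [->//|yx].
  have : y \notin [set x | s x != t x]%SET by rewrite ex inE.
  by rewrite inE negbK => /eqP ->.
exists x; apply/setP => y; rewrite !inE ffunE.
by have [->|_] := eqVneq y x; rewrite ?eqxx // eq_sym.
Qed.

Lemma adjacent_upd (s : config) x c : c != s x -> adjacent s (upd s x c).
Proof. by move=> cx; apply/adjacentP; exists x, c. Qed.

Definition ising (s : config) := [forall x, s x != spin3].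

Lemma isingP (s : config) x : ising s -> s x = spin1 \/ s x = spin2.
Proof.
move/forallP/(_ x)/eqP => n3; have := ltn_ord (s x).
case e: (val (s x)) => [|[|[|m]]] // _; [left|right|case: n3]; exact: val_inj.
Qed.

Lemma ising_not1 (s : config) x : ising s -> (s x != spin1) = (s x == spin2).
Proof. by move=> si; case: (isingP x si) => ->. Qed.
Lemma ising_not2 (s : config) x : ising s -> (s x != spin2) = (s x == spin1).
Proof. by move=> si; case: (isingP x si) => ->. Qed.

Lemma agree_ising (s : config) x : ising s -> (agree s x spin1 + agree s x spin2 = 4)%N.
Proof.
move=> si; rewrite /agree.
by case: (isingP (east x) si) => ->; case: (isingP (west x) si) => ->;
   case: (isingP (north x) si) => ->; case: (isingP (south x) si) => ->.
Qed.

Lemma ising_upd (s : config) x c : ising s -> c != spin3 -> ising (upd s x c).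
Proof.
move=> /forallP si c3; apply/forallP => y; rewrite ffunE; case: ifP => // _; exact: si.
Qed.

End Torus.

(** * Paths of Ising configurations *)

Section IsingPaths.
Variables (K L : nat) (R : realType) (h : spin -> R).
Hypothesis K_gt2 : (2 < K)%N.
Hypothesis L_gt2 : (2 < L)%N.
Hypothesis h_gt0 : 0 < h spin2 - h spin1.
Hypothesis h_lt1 : h spin2 - h spin1 < 1.
Notation site := (site K L).
Notation config := (config K L).
Local Notation H := (hamiltonian (K := K) (L := L) h).
Local Notation h12 := (h spin2 - h spin1).

(** A 3 loses all bonds at [x]. If at least two neighbours are 2s, it is compared with a 2 at [x],
    which has at least two bonds more. Otherwise three neighbours are 1s, and the comparison with a
    1 gives [3 - (h spin3 - h spin1)], which is larger because [h spin2 - h spin1 < 1]. *)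
Lemma third_spin_cost (s : config) x (E : R) : ising s ->
  h spin2 < h spin3 -> h spin3 - h spin1 < 1 ->
  E <= H (upd s x spin1) -> E <= H (upd s x spin2) ->
  E + 2 - (h spin3 - h spin2) <= H (upd s x spin3).
Proof.
move=> si h23 h13.
have a3 : agree s x spin3 = 0%N.
  by rewrite /agree !(negbTE (forallP si _)).
have := agree_ising x si; rewrite !(hamiltonian_upd K_gt2 L_gt2) a3.
move: (agree s x spin1) (agree s x spin2) => a b ab.
have [a2|a2] := leqP a 2.
  have : (a%:R : R) <= 2 by rewrite ler_nat.
  have : a%:R + b%:R = 4 :> R by rewrite -natrD ab.
  by move=> *; lra.
have : (3 : R) <= a%:R by rewrite ler_nat.
by move=> *; lra.
Qed.

Lemma flip12 (s : config) x : ising s -> s x = spin1 ->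
  H (upd s x spin2) = H s + 4 - 2 * (agree s x spin2)%:R - h12.
Proof.
move=> si sx; rewrite (hamiltonian_upd K_gt2 L_gt2) sx.
have /(congr1 (fun n => n%:R : R)) := agree_ising x si; rewrite natrD => e; lra.
Qed.

Lemma flip21 (s : config) x : ising s -> s x = spin2 ->
  H (upd s x spin1) = H s + 4 - 2 * (agree s x spin1)%:R + h12.
Proof.
move=> si sx; rewrite (hamiltonian_upd K_gt2 L_gt2) sx.
have /(congr1 (fun n => n%:R : R)) := agree_ising x si; rewrite natrD => e; lra.
Qed.

Definition ising_step (M : R) : rel config := fun s t =>
  [&& ising s, ising t, adjacent s t, H s <= M & H t <= M].

Lemma ising_step_le M M' s t : M <= M' ->
  connect (ising_step M) s t -> connect (ising_step M') s t.
Proof.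
move=> MM'; apply: connect_sub => {s t} s t /and5P[h1 h2 h3 h4 h5].
by apply: connect1; rewrite /ising_step h1 h2 h3 !(le_trans _ MM').
Qed.

Lemma connect_chain (T : finType) (r : rel T) (S : nat -> T) k :
  (forall j, (j < k)%N -> r (S j) (S j.+1)) -> connect r (S 0%N) (S k).
Proof.
elim: k => [|k IH] hr; first exact: connect0.
apply: connect_trans (IH _) _; last by apply: connect1; apply: hr.
by move=> j jk; apply: hr; apply: ltnW.
Qed.

Definition fill (s : config) (f : nat -> site) (c : spin) (j : nat) : config :=
  [ffun z => if z \in map f (iota 0 j) then c else s z].

Lemma fill0 (s : config) f c : fill s f c 0 = s.
Proof. by apply/ffunP => z; rewrite ffunE. Qed.

Lemma fillS (s : config) f c j : fill s f c j.+1 = upd (fill s f c j) (f j) c.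
Proof.
apply/ffunP => z; rewrite !ffunE -addn1 iotaD map_cat mem_cat /= inE add0n.
by case: eqVneq => // _; rewrite ?orbT ?orbF.
Qed.

Lemma fill_in (s : config) f c j z : s z = c -> fill s f c j z = c.
Proof. by move=> sz; rewrite ffunE sz if_same. Qed.

Lemma fill_lt (s : config) f c j i : (i < j)%N -> fill s f c j (f i) = c.
Proof. by move=> ij; rewrite ffunE map_f // mem_iota. Qed.

Lemma fill_new (s : config) f c j :
  (forall i, (i < j)%N -> f i != f j) -> fill s f c j (f j) = s (f j).
Proof.
move=> fj; rewrite ffunE ifN //; apply/mapP => -[i]; rewrite mem_iota => /= ij e.
by have := fj i ij; rewrite e eqxx.
Qed.

Lemma ising_fill (s : config) f c j : c != spin3 -> ising s -> ising (fill s f c j).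
Proof.
move=> c3 /forallP si; apply/forallP => y; rewrite ffunE; case: ifP => // _; exact: si.
Qed.

Section Directions.
Variables (u u' r r' : site -> site) (N : nat).
Hypothesis uK : cancel u u'.
Hypothesis u'K : cancel u' u.
Hypothesis rK : cancel r r'.
Hypothesis r'K : cancel r' r.
Hypothesis ur : forall x, u (r x) = r (u x).
Hypothesis agreeE : forall s x c, agree s x c =
  ((s (u x) == c) + (s (u' x) == c) + (s (r x) == c) + (s (r' x) == c))%N.
Hypothesis r_inj : forall x i j, (i < N)%N -> (j < N)%N -> iter i r x = iter j r x -> i = j.

(** Here [r] runs along a row and [u] points to the adjacent one, so that both orientations are
    covered. The first new 2 touches one 2 and costs [2 - h12]; each later one also touches its
    predecessor and gains [h12]. *)
Lemma grow_row (s : config) x k : ising s -> (0 < k)%N -> (k <= N)%N ->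
  (forall i, (i < k)%N -> s (iter i r x) = spin2 /\ s (u (iter i r x)) = spin1) ->
  let t := fill s (fun i => u (iter i r x)) spin2 k in
  H t <= H s + 2 - h12 * k%:R /\ connect (ising_step (H s + 2 - h12)) s t.
Proof.
move=> si k0 kN run; set f := fun i => u (iter i r x).
have f_new j : (j < k)%N -> fill s f spin2 j (f j) = spin1.
  move=> jk; rewrite fill_new; first by case: (run j jk).
  move=> i ij; apply/eqP => /(can_inj uK) e.
  have := r_inj (leq_trans (ltn_trans ij jk) kN) (leq_trans jk kN) e.
  by move=> eij; rewrite eij ltnn in ij.
have isf j : ising (fill s f spin2 j) by apply: ising_fill.
have energy j : (j < k)%N -> H (fill s f spin2 j.+1) <= H s + 2 - h12 * j.+1%:R.
  elim: j => [|j IH] jk.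
    rewrite fillS flip12 ?f_new // fill0.
    have : (1 <= agree s (f 0%N) spin2)%N.
      by rewrite agreeE /f uK; case: (run 0%N jk) => -> _; rewrite eqxx; lia.
    by rewrite -(ler_nat R) mulr1; lra.
  rewrite fillS flip12 ?f_new //.
  have := IH (ltnW jk).
  have : (2 <= agree (fill s f spin2 j.+1) (f j.+1) spin2)%N.
    have e1 : fill s f spin2 j.+1 (iter j.+1 r x) = spin2.
      by apply: fill_in; case: (run j.+1 jk).
    rewrite agreeE uK e1.
    have -> : r' (u (iter j.+1 r x)) = f j by rewrite iterS ur rK.
    by rewrite fill_lt // eqxx; lia.
  by rewrite -(ler_nat R) -[j.+2%:R]natr1; lra.
have height j : (j <= k)%N -> H (fill s f spin2 j) <= H s + 2 - h12.
  case: j => [|j] jk; first by rewrite fill0; move: h_lt1; lra.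
  apply: le_trans (energy j jk) _.
  have : (1 : R) <= j.+1%:R by rewrite ler1n.
  move: h_gt0; nra.
split; first by have := energy k.-1; rewrite prednK //; apply.
have := @connect_chain _ (ising_step (H s + 2 - h12)) (fill s f spin2) k; rewrite fill0.
apply=> j jk; apply/and5P; split; rewrite ?isf ?height ?(ltnW jk) //.
by rewrite fillS; apply: adjacent_upd; rewrite f_new.
Qed.

(** The run is erased from one end. Each erased site has at least two neighbours 1, above and
    behind, and costs at most [h12]; the last has a third one ahead and regains 2. The height stays
    within [h12 * (m - 1)], which is at most [2 - h12]. *)
Lemma shrink_row (s : config) x m : ising s -> (0 < m)%N -> (m <= N)%N ->
  s (r' x) = spin1 -> s (iter m r x) = spin1 ->
  (forall i, (i < m)%N -> s (iter i r x) = spin2 /\ s (u (iter i r x)) = spin1) ->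
  h12 * m%:R <= 2 ->
  let t := fill s (fun i => iter i r x) spin1 m in
  H t <= H s + h12 * m%:R - 2 /\ connect (ising_step (H s + 2 - h12)) s t.
Proof.
move=> si m0 mN left right run hm; set f := fun i => iter i r x.
have f_new j : (j < m)%N -> fill s f spin1 j (f j) = spin2.
  move=> jm; rewrite fill_new; first by case: (run j jm).
  move=> i ij; apply/eqP => e.
  have := r_inj (leq_trans (ltn_trans ij jm) mN) (leq_trans jm mN) e.
  by move=> eij; rewrite eij ltnn in ij.
have isf j : ising (fill s f spin1 j) by apply: ising_fill.
have back j : (j < m)%N -> fill s f spin1 j (r' (f j)) = spin1.
  case: j => [|j] jm; first exact: fill_in.
  by rewrite /f iterS rK fill_lt.
have step j : (j < m)%N ->
    (2 + (j.+1 == m) <= agree (fill s f spin1 j) (f j) spin1)%N.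
  move=> jm; rewrite agreeE back // [fill _ _ _ _ (u _)]fill_in; last by case: (run j jm).
  case: eqP => [e|_]; last by rewrite !eqxx; lia.
  by rewrite [fill _ _ _ _ (r _)]fill_in ?eqxx; [lia|rewrite /f -iterS e].
have energy j : (j < m)%N -> H (fill s f spin1 j) <= H s + h12 * j%:R.
  elim: j => [|j IH] jm; first by rewrite fill0; lra.
  rewrite fillS flip21 ?f_new // ?(ltnW jm) //.
  have := step j (ltnW jm); rewrite ltn_eqF // addn0 -(ler_nat R).
  have := IH (ltnW jm); rewrite -[j.+1%:R]natr1; lra.
have final : H (fill s f spin1 m) <= H s + h12 * m%:R - 2.
  case: (m) m0 energy step f_new => // m' _ energy step f_new.
  rewrite fillS flip21 ?f_new //.
  have := step m' (leqnn _); rewrite eqxx (_ : (2 + true)%N = 3%N) // -(ler_nat R).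
  have := energy m' (leqnn _); rewrite -[m'.+1%:R]natr1; lra.
have height j : (j <= m)%N -> H (fill s f spin1 j) <= H s + 2 - h12.
  rewrite leq_eqVlt => /orP[/eqP ->|jm]; first by apply: le_trans final _; move: h_lt1 hm; lra.
  apply: le_trans (energy j jm) _.
  have : (j.+1%:R : R) <= m%:R by rewrite ler_nat.
  rewrite -natr1; move: h_gt0; nra.
split=> //.
have := @connect_chain _ (ising_step (H s + 2 - h12)) (fill s f spin1) m; rewrite fill0.
apply=> j jm; apply/and5P; split; rewrite ?isf ?height ?(ltnW jm) //.
by rewrite fillS; apply: adjacent_upd; rewrite f_new.
Qed.

(* k is the length from which a row of 2s grows rather than shrinks. *)
Lemma descent_along (s : config) x k : ising s -> (0 < k)%N -> (k <= N)%N ->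
  2 < h12 * k%:R -> (forall m, (m < k)%N -> h12 * m%:R < 2) ->
  s x = spin2 -> s (u x) = spin1 ->
  exists t, [/\ ising t, H t < H s & connect (ising_step (H s + 2 - h12)) s t].
Proof.
move=> si k0 kN hk hm sx sux.
have [/existsP[y /andP[/orP hy1 hy2]]|/existsPn locmin] :=
    boolP [exists y, ((s y == spin1) || (s y == spin2)) &&
      (H (upd s y (if s y == spin1 then spin2 else spin1)) < H s)].
  set c := (if _ then _ else _) in hy2.
  have c3 : c != spin3 by rewrite /c; case: ifP.
  exists (upd s y c); rewrite hy2 ising_upd //; split=> //.
  apply: connect1; rewrite /ising_step si ising_upd // adjacent_upd //=.
    by apply/andP; split; [|apply: ltW; apply: (lt_trans hy2)]; move: h_lt1; lra.
  by rewrite /c; case: hy1 => /eqP ->.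
(* From here on no single flip lowers the energy; a 1 with two neighbours 2 would be such a flip. *)
have few y : s y = spin1 -> (agree s y spin2 <= 1)%N.
  move=> sy; have := locmin y; rewrite sy /= -leNgt flip12 // => le.
  rewrite leqNgt; apply/negP; rewrite -(ler_nat R); move: h_gt0; lra.
(* The site [u x'] has already its one neighbour 2, namely [x'], so the next site along the row is a
   1: the boundary of the 2s continues straight. *)
have along x' (g : site -> site) : (g = r \/ g = r') -> s x' = spin2 -> s (u x') = spin1 ->
    s (u (g x')) = spin1.
  move=> eg sx' sux'; have := few _ sux'; rewrite agreeE uK sx' eqxx /=.
  have -> : u (g x') = g (u x').
    case: eg => ->; first exact: ur.
    by apply: (can_inj rK); rewrite r'K -ur r'K.
  have : s (g (u x')) == spin2 -> ((s (r (u x')) == spin2) || (s (r' (u x')) == spin2)).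
    by case: eg => -> ->; rewrite ?orbT.
  case: (isingP (g (u x')) si) => // -> /(_ (eqxx _)) /orP[] ->; lia.
have gr y : (forall i, (i < k)%N -> s (iter i r y) = spin2 /\ s (u (iter i r y)) = spin1) ->
    exists t, [/\ ising t, H t < H s & connect (ising_step (H s + 2 - h12)) s t].
  move=> run; have [h1 h2] := grow_row si k0 kN run.
  exists (fill s (fun i => u (iter i r y)) spin2 k); split=> //; first exact: ising_fill.
  by apply: le_lt_trans h1 _; move: hk; lra.
(* [y] is a 2 below a 1 that begins a run, its predecessor being a 1. From there the run either
   reaches length [k] and grows, or stops earlier and shrinks. *)
have [/existsP[y /and3P[/eqP sy /eqP suy sry]]|/existsPn nl] :=
    boolP [exists y, [&& s y == spin2, s (u y) == spin1 & s (r' y) != spin2]]; last first.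
  have run i : s (iter i r' x) = spin2 /\ s (u (iter i r' x)) = spin1.
    elim: i => [//|i [h1 h2]]; rewrite iterS; split; last exact: (along _ r' (or_intror erefl) h1 h2).
    by have := nl (iter i r' x); rewrite h1 h2 !eqxx /= negbK => /eqP.
  (* No run has a beginning, so the 2s extend backwards from [x] without end, and a run of length
     [k] starts [k - 1] steps behind. *)
  apply: (gr (iter k.-1 r' x)) => i ik.
  have -> : iter i r (iter k.-1 r' x) = iter (k.-1 - i) r' x; last exact: run.
  elim: i ik => [|i IH] ik; first by rewrite subn0.
  rewrite iterS IH ?(ltnW ik) //.
  have -> : (k.-1 - i = (k.-1 - i.+1).+1)%N by lia.
  by rewrite iterS r'K.
have sry1 : s (r' y) = spin1 by apply/eqP; rewrite -ising_not2.
have [/forallP all2|] := boolP [forall i : 'I_k, s (iter i r y) == spin2].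
  apply: (gr y) => i; elim: i => [//|i IH] ik.
  have [h1 h2] := IH (ltnW ik).
  by split; [apply/eqP; exact: (all2 (Ordinal ik))|exact: (along _ r (or_introl erefl) h1 h2)].
rewrite negb_forall => /existsP[i0 hi0].
have ex : exists m, s (iter m r y) != spin2 by exists i0.
have sm := ex_minnP ex; case: sm => m sm mmin.
have mk : (m < k)%N by apply: leq_ltn_trans (ltn_ord i0); apply: mmin.
have below i : (i < m)%N -> s (iter i r y) = spin2.
  by move=> im; apply/eqP; apply: contraTT im => /mmin; rewrite -leqNgt.
have run i : (i < m)%N -> s (iter i r y) = spin2 /\ s (u (iter i r y)) = spin1.
  elim: i => [//|i IH] im; have [h1 h2] := IH (ltnW im).
  by split; [exact: below|exact: (along _ r (or_introl erefl) h1 h2)].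
have m0 : (0 < m)%N by case: (m) sm => //=; rewrite sy.
have smr : s (iter m r y) = spin1 by apply/eqP; rewrite -ising_not2.
have [h1 h2] := shrink_row si m0 (leq_trans (ltnW mk) kN) sry1 smr run (ltW (hm m mk)).
exists (fill s (fun i => iter i r y) spin1 m); split=> //; first exact: ising_fill.
by apply: le_lt_trans h1 _; have := hm m mk; lra.
Qed.

End Directions.
End IsingPaths.

(** * Descent and nucleation in the landscape of 1s and 2s *)

Section IsingLandscape.
Variables (K L : nat) (R : realType) (h : spin -> R).
Hypothesis K_gt2 : (2 < K)%N.
Hypothesis L_gt2 : (2 < L)%N.
Hypothesis h_gt0 : 0 < h spin2 - h spin1.
Hypothesis h_lt1 : h spin2 - h spin1 < 1.
Notation site := (site K L).
Notation config := (config K L).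
Local Notation H := (hamiltonian (K := K) (L := L) h).
Local Notation h12 := (h spin2 - h spin1).

Let ne x : north (east x) = east (north x) :> site. Proof. by []. Qed.
Let en x : east (north x) = north (east x) :> site. Proof. by []. Qed.

Let agree_ne (s : config) x c : agree s x c =
  ((s (north x) == c) + (s (south x) == c) + (s (east x) == c) + (s (west x) == c))%N.
Proof. by rewrite /agree -addnA addnC addnA. Qed.

Let agree_en (s : config) x c : agree s x c =
  ((s (east x) == c) + (s (west x) == c) + (s (north x) == c) + (s (south x) == c))%N.
Proof. by []. Qed.

Lemma iter_east (x : site) i : iter i (@east K L) x = (iter i (@ordS K) x.1, x.2).
Proof. by elim: i => [|i /= ->] //; case: (x). Qed.

Lemma iter_north (x : site) i : iter i (@north K L) x = (x.1, iter i (@ordS L) x.2).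
Proof. by elim: i => [|i /= ->] //; case: (x). Qed.

Let east_inj (x : site) i j : (i < K)%N -> (j < K)%N ->
  iter i (@east K L) x = iter j (@east K L) x -> i = j.
Proof. by move=> iK jK; rewrite !iter_east => -[] /iter_ordS_inj; apply. Qed.

Let north_inj (x : site) i j : (i < L)%N -> (j < L)%N ->
  iter i (@north K L) x = iter j (@north K L) x -> i = j.
Proof. by move=> iK jK; rewrite !iter_north => -[] /iter_ordS_inj; apply. Qed.

(** The boundary between 2s and 1s is followed in whichever direction it is found; [k] is at most
    both sides, so the row that grows does not wrap. *)
Lemma ising_descent (s : config) k : ising s ->
  s != const_config K L spin1 -> s != const_config K L spin2 ->
  (0 < k)%N -> (k <= K)%N -> (k <= L)%N ->
  2 < h12 * k%:R -> (forall m, (m < k)%N -> h12 * m%:R < 2) ->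
  exists t, [/\ ising t, H t < H s & connect (ising_step h (H s + 2 - h12)) s t].
Proof.
move=> si s1 s2 k0 kK kL hk hm.
have [/existsP[x /andP[/eqP sx /eqP sn]]|/existsPn noN] :=
    boolP [exists x, (s x == spin2) && (s (north x) == spin1)].
  exact: (descent_along K_gt2 L_gt2 h_gt0 h_lt1 (@northK K L) (@eastK K L)
    (@westK K L) ne agree_ne east_inj si k0 kK hk hm sx sn).
have [/existsP[x /andP[/eqP sx /eqP sn]]|/existsPn noE] :=
    boolP [exists x, (s x == spin2) && (s (east x) == spin1)].
  exact: (descent_along K_gt2 L_gt2 h_gt0 h_lt1 (@eastK K L) (@northK K L)
    (@southK K L) en agree_en north_inj si k0 kL hk hm sx sn).
(* Without a 2 whose north or east neighbour is a 1, one 2 spreads over the whole torus. *)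
exfalso; have [x sx] : exists x, s x = spin2.
  apply: contrapT => nx; move/eqP: s1; apply; apply/ffunP => x; rewrite ffunE.
  by case: (isingP x si) => // e; case: nx; exists x.
have stepE i : s (iter i (@east K L) x) = spin2.
  elim: i => //= i IH; have := noE (iter i (@east K L) x); rewrite IH eqxx /= => n1.
  by apply/eqP; rewrite -ising_not1.
have stepN i y : s y = spin2 -> s (iter i (@north K L) y) = spin2.
  move=> sy; elim: i => //= i IH; have := noN (iter i (@north K L) y).
  by rewrite IH eqxx /= => n1; apply/eqP; rewrite -ising_not1.
move/eqP: s2; apply; apply/ffunP => y; rewrite ffunE.
have [i ei] := iter_ordS_reach x.1 y.1; have [j ej] := iter_ordS_reach x.2 y.2.
have -> : y = iter j (@north K L) (iter i (@east K L) x).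
  by rewrite iter_north iter_east /= ei ej; case: (y).
exact: stepN.
Qed.

Definition rect (a b : nat) : config :=
  [ffun z : site => if (z.1 < a)%N && (z.2 < b)%N then spin2 else spin1].

Lemma ising_rect a b : ising (rect a b).
Proof. by apply/forallP => z; rewrite ffunE; case: ifP. Qed.

Lemma val_iter_ordS0 n i (z : 'I_n) : val z = 0%N -> (i < n)%N ->
  val (iter i (@ordS n) z) = i.
Proof. by move=> z0 lt; rewrite val_iter_ordS z0 add0n modn_small. Qed.

Let K0 : (0 < K)%N. Proof. exact: leq_trans K_gt2. Qed.
Let L0 : (0 < L)%N. Proof. exact: leq_trans L_gt2. Qed.

Lemma rect_grow_north a b : (0 < a)%N -> (a <= K)%N -> (0 < b)%N -> (b < L)%N ->
  H (rect a b.+1) <= H (rect a b) + 2 - h12 * a%:R /\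
  connect (ising_step h (H (rect a b) + 2 - h12)) (rect a b) (rect a b.+1).
Proof.
move=> a0 aK b0 bL.
have bL' : (b.-1 < L)%N by rewrite (leq_ltn_trans (leq_pred b)).
pose x : site := (Ordinal K0, Ordinal bL').
have xi i : (i < K)%N -> val (iter i (@east K L) x).1 = i.
  by move=> iK; rewrite iter_east /= val_iter_ordS0.
have xi2 i : val (iter i (@east K L) x).2 = b.-1 by rewrite iter_east.
have nb i : val (north (iter i (@east K L) x)).2 = b.
  by rewrite /north /= iter_east /= prednK // modn_small.
have run i : (i < a)%N -> rect a b (iter i (@east K L) x) = spin2 /\
    rect a b (north (iter i (@east K L) x)) = spin1.
  move=> ia; have iK := leq_trans ia aK; split; rewrite ffunE.
    by rewrite [X in (X < a)%N]xi // [X in (X < b)%N]xi2 ia prednK // leqnn.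
  by rewrite [X in _ && (X < b)%N]nb ltnn andbF.
have := grow_row K_gt2 L_gt2 h_gt0 h_lt1 (@northK K L) (@eastK K L) ne agree_ne
  east_inj (ising_rect a b) a0 aK run.
rewrite /=; set t := fill _ _ _ _; suff -> : t = rect a b.+1 by [].
apply/ffunP => z; rewrite !ffunE.
have -> : (z \in [seq north (iter i (@east K L) x) | i <- iota 0 a]) =
    (z.1 < a)%N && (val z.2 == b).
  apply/mapP/andP => [[i]|[z1 /eqP z2]].
    rewrite mem_iota => /= ia ->; rewrite nb eqxx; split=> //.
    by rewrite /north /= [X in (X < a)%N]xi // (leq_trans ia).
  exists (val z.1); first by rewrite mem_iota.
  case: z z1 z2 => z1 z2 /= z1a z2b; congr pair; apply: val_inj => /=.
    by rewrite xi.
  by rewrite iter_east /= prednK // modn_small.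
have -> : (z.2 < b.+1)%N = (val z.2 == b) || (z.2 < b)%N by rewrite ltnS leq_eqVlt.
by case: (z.1 < a)%N => //=; case: (val z.2 == b).
Qed.

Lemma rect_grow_east a b : (0 < b)%N -> (b <= L)%N -> (0 < a)%N -> (a < K)%N ->
  H (rect a.+1 b) <= H (rect a b) + 2 - h12 * b%:R /\
  connect (ising_step h (H (rect a b) + 2 - h12)) (rect a b) (rect a.+1 b).
Proof.
move=> b0 bL a0 aK.
have aK' : (a.-1 < K)%N by rewrite (leq_ltn_trans (leq_pred a)).
pose x : site := (Ordinal aK', Ordinal L0).
have xi i : (i < L)%N -> val (iter i (@north K L) x).2 = i.
  by move=> iL; rewrite iter_north /= val_iter_ordS0.
have xi2 i : val (iter i (@north K L) x).1 = a.-1 by rewrite iter_north.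
have nb i : val (east (iter i (@north K L) x)).1 = a.
  by rewrite /east /= iter_north /= prednK // modn_small.
have run i : (i < b)%N -> rect a b (iter i (@north K L) x) = spin2 /\
    rect a b (east (iter i (@north K L) x)) = spin1.
  move=> ib; have iL := leq_trans ib bL; split; rewrite ffunE.
    by rewrite [X in (X < a)%N]xi2 // [X in (X < b)%N]xi // ib prednK // leqnn.
  by rewrite [X in (X < a)%N && _]nb ltnn.
have := grow_row K_gt2 L_gt2 h_gt0 h_lt1 (@eastK K L) (@northK K L) en agree_en
  north_inj (ising_rect a b) b0 bL run.
rewrite /=; set t := fill _ _ _ _; suff -> : t = rect a.+1 b by [].
apply/ffunP => z; rewrite !ffunE.
have -> : (z \in [seq east (iter i (@north K L) x) | i <- iota 0 b]) =
    (val z.1 == a) && (z.2 < b)%N.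
  apply/mapP/andP => [[i]|[/eqP z1 z2]].
    rewrite mem_iota => /= ib ->; rewrite nb eqxx; split=> //.
    by rewrite /east /= [X in (X < b)%N]xi // (leq_trans ib).
  exists (val z.2); first by rewrite mem_iota.
  case: z z1 z2 => z1 z2 /= z1a z2b; congr pair; apply: val_inj => /=.
    by rewrite iter_north /= prednK // modn_small.
  by rewrite xi.
have -> : (z.1 < a.+1)%N = (val z.1 == a) || (z.1 < a)%N by rewrite ltnS leq_eqVlt.
by case: (z.2 < b)%N => //=; rewrite ?andbF // !andbT; case: (val z.1 == a).
Qed.

Lemma rect_full : rect K L = const_config K L spin2.
Proof. by apply/ffunP => z; rewrite !ffunE !ltn_ord. Qed.

(* The height of the path that grows a droplet row by row is attained at the
   protocritical droplets of k (k - 1) + 1 sites. *)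
Lemma nucleation_path (M : R) :
  (forall k : nat, 4 * k%:R - h12 * (k%:R * (k%:R - 1) + 1) <= M) ->
  2 <= h12 * K%:R -> 2 <= h12 * L%:R ->
  connect (ising_step h (H (const_config K L spin1) + M))
    (const_config K L spin1) (const_config K L spin2).
Proof.
move=> barM hK hL; set s1 := const_config K L spin1.
have s1i : ising s1 by apply/forallP => z; rewrite ffunE.
have M0 : 0 <= M by have := barM 1%N; move: h_lt1; rewrite mulr1; lra.
(* Half the boundary counted twice, minus the field on the area. Only an upper bound is kept, so it
   stays valid when the rectangle wraps around the torus and loses part of its boundary. *)
pose good a b := H (rect a b) <= H s1 + 2 * (a%:R + b%:R) - h12 * (a%:R * b%:R) /\
  connect (ising_step h (H s1 + M)) s1 (rect a b).
have good_north a b : (0 < a)%N -> (a <= K)%N -> (0 < b)%N -> (b < L)%N ->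
    2 * (a%:R + b%:R + 1) - h12 * (a%:R * b%:R + 1) <= M -> good a b -> good a b.+1.
  move=> a0 aK b0 bL bump [g1 g2]; have [e c] := rect_grow_north a0 aK b0 bL.
  split; first by rewrite -[b.+1%:R]natr1; move: g1 e; lra.
  apply: connect_trans g2 _; apply: ising_step_le c; move: g1 bump; lra.
have good_east a b : (0 < b)%N -> (b <= L)%N -> (0 < a)%N -> (a < K)%N ->
    2 * (a%:R + b%:R + 1) - h12 * (a%:R * b%:R + 1) <= M -> good a b -> good a.+1 b.
  move=> b0 bL a0 aK bump [g1 g2]; have [e c] := rect_grow_east b0 bL a0 aK.
  split; first by rewrite -[a.+1%:R]natr1; move: g1 e; lra.
  apply: connect_trans g2 _; apply: ising_step_le c; move: g1 bump; lra.
(* A bump on a [k] by [k] square is exactly the average of the hypothesis at [k] and at [k + 1]. *)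
have square_bump (k : nat) : 2 * (k%:R + k%:R + 1) - h12 * (k%:R * k%:R + 1) <= M.
  have := barM k; have := barM k.+1; rewrite -[k.+1%:R]natr1; lra.
have good11 : good 1%N 1%N.
  pose x : site := (Ordinal K0, Ordinal L0).
  have e : rect 1 1 = upd s1 x spin2.
    apply/ffunP => -[z1 z2]; rewrite !ffunE /= !ltnS !leqn0 xpair_eqE.
    by congr (if _ then _ else _); rewrite -!val_eqE.
  have E : H (rect 1 1) <= H s1 + 4 - h12.
    rewrite e (flip12 h K_gt2 L_gt2) ?ffunE //.
    have : (0 : R) <= (agree s1 x spin2)%:R by rewrite ler0n.
    lra.
  split; first by move: E; lra.
  apply: connect1; rewrite /ising_step s1i ising_rect e adjacent_upd ?ffunE //=.
  by rewrite -e; have := barM 1%N; move: E M0; rewrite mulr1; lra.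
have square k : (k < K)%N -> (k < L)%N -> good k.+1 k.+1.
  elim: k => [//|k IH] kK kL; have g := IH (ltnW kK) (ltnW kL).
  (* The bump on the longer side of a quasi-square is exactly the hypothesis at [k + 2]; the bump on
     the preceding square is handled by [square_bump]. *)
  apply: good_north => //.
    have := barM k.+2; rewrite -[k.+2%:R]natr1; lra.
  by apply: good_east => //; exact: ltnW.
suff [] : good K L by rewrite rect_full.
have [KL|LK] := leqP K L.
  have base : good K K.
    by rewrite -(prednK K0); apply: square; rewrite ?prednK // (leq_trans _ KL) // prednK.
  (* Once the droplet spans the side [K], the bump bound differs from that of the [K] by [K] square
     by [j * (2 - h12 * K)], which is nonpositive. *)
  have ext j : (K + j <= L)%N -> good K (K + j)%N.
    elim: j => [|j IH] jL; first by rewrite addn0.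
    rewrite addnS in jL *; apply: good_north => //; first by rewrite addn_gt0 K0.
      have := square_bump K; rewrite natrD.
      have : (0 : R) <= j%:R by rewrite ler0n.
      move: hK; nra.
    exact: IH (ltnW jL).
  by have := ext (L - K)%N; rewrite subnKC //; apply.
have base : good L L.
  rewrite -(prednK L0); apply: square; rewrite ?prednK //.
  exact: ltnW.
have ext j : (L + j <= K)%N -> good (L + j)%N L.
  elim: j => [|j IH] jL; first by rewrite addn0.
  rewrite addnS in jL *; apply: good_east => //; first by rewrite addn_gt0 L0.
    have := square_bump L; rewrite natrD.
    have : (0 : R) <= j%:R by rewrite ler0n.
    move: hL; nra.
  exact: IH (ltnW jL).
by have := ext (K - L)%N; rewrite subnKC ?(ltnW LK) //; apply.
Qed.

End IsingLandscape.

(** * Isoperimetric cuts *)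

(** Around the cycle there is an exit from [b] and a return to it, at two different places. *)
Lemma cyclic_changes n (b : pred 'I_n) i j : b i -> ~~ b j ->
  (2 <= \sum_(t < n) (b t != b (ordS t)))%N.
Proof.
have jump (c : pred 'I_n) t t' : c t -> ~~ c t' -> exists t0, c t0 && ~~ c (ordS t0).
  move=> ct nct'; apply/existsP; apply: contraNT nct'; rewrite negb_exists => /forallP nj.
  have [k <-] := iter_ordS_reach t t'.
  elim: k => //= k IH; have := nj (iter k (@ordS n) t).
  by rewrite IH /= negbK.
move=> bi nbj.
have [t1 /andP[b1 nb1]] := jump b i j bi nbj.
have [] := jump (predC b) j i; rewrite /= ?negbK // => t2 /andP[nb2].
rewrite negbK => b2.
have t12 : t2 != t1 by apply/eqP => e; move: nb2; rewrite e b1.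
rewrite (bigD1 t1) //= (bigD1 t2) //= b1 (negbTE nb1) (negbTE nb2) b2 /=.
by rewrite addnA leq_addr.
Qed.

(** If [p + q <= 2 m + 1], then [4 p q <= (2 m + 1) ^ 2 = 4 (m + 1) m + 1], so the integer [p q] is
    at most [(m + 1) m]. *)
Lemma half_perimeter (p q m : nat) : (m.+1 * m < p * q)%N -> (m.+1.*2 <= p + q)%N.
Proof.
move=> lt; rewrite leqNgt; apply/negP => lt2.
have := (nat_AGM2 p q).1; have : ((p + q) ^ 2 <= (2 * m + 1) ^ 2)%N.
  by rewrite leq_exp2r //; lia.
have -> : ((2 * m + 1) ^ 2 = 4 * (m.+1 * m) + 1)%N by rewrite -mulnn; lia.
lia.
Qed.

(** The two alternatives are the ways of leaving the small droplets: reaching the critical area, or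
    opening a new line that holds a single site. *)
Lemma droplet_barrier (R : realFieldType) (p q n m : nat) (hm : R) :
  0 <= hm -> 2 <= hm * m.+1%:R -> (n <= m.+1 * m + 1)%N ->
  (n = (m.+1 * m + 1)%N /\ (n <= p * q)%N) \/ (q = m.+2 /\ (n <= p * m.+1 + 1)%N) ->
  4 * m.+1%:R - hm * (m.+1%:R * (m.+1%:R - 1) + 1) <= 2 * (p%:R + q%:R) - hm * n%:R.
Proof.
move=> hm0 hm2 nle.
have nleR : (n%:R : R) <= m.+1%:R * (m.+1%:R - 1) + 1.
  move: nle; rewrite -(ler_nat R) natrD natrM.
  by have -> : m%:R = m.+1%:R - 1 :> R by rewrite -natr1; ring.
have big : (m.+1.*2 <= p + q)%N ->
    4 * m.+1%:R - hm * (m.+1%:R * (m.+1%:R - 1) + 1) <= 2 * (p%:R + q%:R) - hm * n%:R.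
  rewrite -mul2n -(ler_nat R) natrM natrD => pq.
  have := ler_wpM2l hm0 nleR; lra.
case=> [[en npq]|[eq np]].
  by apply: big; apply: half_perimeter; rewrite en addn1 in npq.
have [pm|pm] := leqP m.+1 p; first by apply: big; rewrite eq; lia.
have npR : (n%:R : R) <= p%:R * m.+1%:R + 1.
  by move: np; rewrite -(ler_nat R) natrD natrM.
have pR : (p%:R : R) <= m.+1%:R - 1.
  by rewrite lerBrDr natr1 ler_nat.
have -> : (q%:R : R) = m.+1%:R + 1 by rewrite eq natr1.
have h1 := ler_wpM2l hm0 npR.
(* The lower bound is affine in [p] with slope [2 - hm * (m + 1) <= 0]; its least value for [p <= m]
   is at [p = m], where it equals the barrier. *)
have : 0 <= (hm * m.+1%:R - 2) * (m.+1%:R - 1 - p%:R).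
  by rewrite mulr_ge0 // subr_ge0.
move: h1; lra.
Qed.

Section Cut.
Variables (K L : nat) (R : realType) (h : spin -> R) (i : spin) (hm : R).
Hypothesis K_gt2 : (2 < K)%N.
Hypothesis L_gt2 : (2 < L)%N.
Hypothesis hm_ge0 : 0 <= hm.
Hypothesis hm_max : forall c, h c - h i <= hm.
Notation site := (site K L).
Notation config := (config K L).
Local Notation H := (hamiltonian (K := K) (L := L) h).

Definition defects (s : config) : {set site} := [set x | s x != i]%SET.
(* Rows are indexed by the first coordinate. *)
Definition defect_rows (s : config) : {set 'I_K} :=
  [set j | [exists k, s (j, k) != i]]%SET.
Definition defect_columns (s : config) : {set 'I_L} :=
  [set k | [exists j, s (j, k) != i]]%SET.

Lemma card_defects s : (#|defects s| <= #|defect_rows s| * #|defect_columns s|)%N.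
Proof.
rewrite -cardsX; apply: subset_leq_card; apply/fintype.subsetP => -[j k].
rewrite !inE /= => sjk; apply/andP.
by split; apply/existsP; [exists k|exists j].
Qed.

(** Some row is free of defects, so every column with a defect also contains the spin [i] and has at
    least two broken bonds; likewise for the rows. Each defect, whatever its spin, is credited with
    the largest field gain [hm]. *)
Lemma perimeter_lower s : (#|defect_rows s| < K)%N -> (#|defect_columns s| < L)%N ->
  H (const_config K L i) + 2 * (#|defect_rows s|%:R + #|defect_columns s|%:R)
    - hm * #|defects s|%:R <= H s.
Proof.
move=> pK qL.
have [j0 j0P] : exists j0, j0 \notin defect_rows s.
  apply/existsP; rewrite -negb_forall; apply: contraL pK => /forallP all.
  rewrite -leqNgt -[leqLHS]card_ord; apply: subset_leq_card.
  by apply/fintype.subsetP => j _; apply: all.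
have [k0 k0P] : exists k0, k0 \notin defect_columns s.
  apply/existsP; rewrite -negb_forall; apply: contraL qL => /forallP all.
  rewrite -leqNgt -[leqLHS]card_ord; apply: subset_leq_card.
  by apply/fintype.subsetP => j _; apply: all.
have s_j0 k : s (j0, k) = i.
  by apply/eqP; move: j0P; rewrite inE negb_exists => /forallP/(_ k); rewrite negbK.
have s_k0 j : s (j, k0) = i.
  by apply/eqP; move: k0P; rewrite inE negb_exists => /forallP/(_ j); rewrite negbK.
have diff (x y : spin) : ((x != i) != (y != i) <= (x != y))%N.
  by case: (eqVneq x y) => [->|_]; [rewrite eqxx|exact: leq_b1].
have horizontal : (2 * #|defect_columns s| <=
    \sum_(k < L) \sum_(j < K) (s (j, k) != s (ordS j, k)))%N.
  rewrite [leqRHS](bigID (mem (defect_columns s))) /=.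
  apply: leq_trans (leq_addr _ _); rewrite mulnC -sum_nat_const.
  apply: leq_sum => k; rewrite inE => /existsP[j sjk].
  apply: leq_trans (@cyclic_changes K (fun j => s (j, k) != i) j j0 sjk _) _.
    by rewrite s_j0 eqxx.
  by apply: leq_sum => t _; apply: diff.
have vertical : (2 * #|defect_rows s| <=
    \sum_(j < K) \sum_(k < L) (s (j, k) != s (j, ordS k)))%N.
  rewrite [leqRHS](bigID (mem (defect_rows s))) /=.
  apply: leq_trans (leq_addr _ _); rewrite mulnC -sum_nat_const.
  apply: leq_sum => j; rewrite inE => /existsP[k sjk].
  apply: leq_trans (@cyclic_changes L (fun k => s (j, k) != i) k k0 sjk _) _.
    by rewrite s_k0 eqxx.
  by apply: leq_sum => t _; apply: diff.
have bondsE (f : site -> site) : bonds R f (const_config K L i) - bonds R f s =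
    (\sum_x (s x != s (f x)))%N%:R :> R.
  rewrite /bonds -sumrB natr_sum; apply: eq_bigr => x _.
  by rewrite !ffunE eqxx; case: eqP; rewrite ?subrr ?subr0.
have field : \sum_x h (s x) - \sum_x h (const_config K L i x) <= hm * #|defects s|%:R.
  rewrite -sumrB mulr_natr -sumr_const [leRHS]big_mkcond /=.
  apply: ler_sum => x _; rewrite ffunE inE; case: eqVneq => [->|_]; first by rewrite subrr.
  exact: hm_max.
have := bondsE (@east K L); have := bondsE (@north K L).
have -> : (\sum_x (s x != s (north x)))%N =
    (\sum_(j < K) \sum_(k < L) (s (j, k) != s (j, ordS k)))%N.
  by rewrite pair_bigA; apply: eq_bigr => -[j k] _.
have -> : (\sum_x (s x != s (east x)))%N =
    (\sum_(k < L) \sum_(j < K) (s (j, k) != s (ordS j, k)))%N.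
  by rewrite exchange_big pair_bigA; apply: eq_bigr => -[j k] _.
move: horizontal vertical; rewrite -(ler_nat R) natrM -[in X in _ -> X](ler_nat R) natrM.
rewrite !(hamiltonianE K_gt2 L_gt2).
move: field; set a := \sum_x _; set b := \sum_x _ => *; lra.
Qed.

(* The critical droplet has m.+1 * m + 1 sites. Bounding the numbers of rows and columns
   keeps the droplet from wrapping around the torus; when one of these bounds is first
   exceeded, the new row or column contains a single defect. *)
Definition small_droplet (m : nat) (s : config) : bool :=
  [&& (#|defect_rows s| <= m.+1)%N, (#|defect_columns s| <= m.+1)%N
    & (#|defects s| < m.+1 * m + 1)%N].

(** One flip raises each of the three counts by at most one. The counts of lines are then at most
    [m + 2], below both sides, so [perimeter_lower] applies to [t]. *)
Lemma small_droplet_exit m s t : (m.+3 <= K)%N -> (m.+3 <= L)%N ->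
  2 <= hm * m.+1%:R ->
  small_droplet m s -> ~~ small_droplet m t -> adjacent s t ->
  H (const_config K L i) + (4 * m.+1%:R - hm * (m.+1%:R * (m.+1%:R - 1) + 1)) <= H t.
Proof.
move=> mK mL hm2 /and3P[ps qs ns] nt /adjacentP[x [c [cx et]]].
have le_card (T : finType) (A B : {set T}) (y : T) : A \subset (y |: B)%SET ->
    (#|A| <= #|B|.+1)%N.
  move=> /subset_leq_card h1; apply: leq_trans h1 _.
  by rewrite cardsU1; case: (_ \notin _).
have tx y : t y != i -> y = x \/ s y != i.
  by rewrite et ffunE; case: (eqVneq y x) => [->|]; [left|right].
have pS : (#|defect_rows t| <= #|defect_rows s|.+1)%N.
  apply: (le_card _ _ _ x.1); apply/fintype.subsetP => j; rewrite !inE => /existsP[k /tx[e|e]].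
    by rewrite -e eqxx.
  by apply/orP; right; apply/existsP; exists k.
have qS : (#|defect_columns t| <= #|defect_columns s|.+1)%N.
  apply: (le_card _ _ _ x.2); apply/fintype.subsetP => k; rewrite !inE => /existsP[j /tx[e|e]].
    by rewrite -e eqxx.
  by apply/orP; right; apply/existsP; exists j.
have nS : (#|defects t| <= #|defects s|.+1)%N.
  apply: (le_card _ _ _ x); apply/fintype.subsetP => y; rewrite !inE => /tx[->|->].
    by rewrite eqxx.
  by rewrite orbT.
(* Removing a defect cannot leave the set, so the exit creates one. *)
have [ci|ci] := eqVneq c i.
  have sub y : t y != i -> s y != i.
    by rewrite et ffunE; case: (eqVneq y x) => // _; rewrite ci eqxx.
  case/negP: nt; apply/and3P; split.
  - apply: leq_trans ps; apply: subset_leq_card; apply/fintype.subsetP => j.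
    by rewrite !inE => /existsP[k /sub e]; apply/existsP; exists k.
  - apply: leq_trans qs; apply: subset_leq_card; apply/fintype.subsetP => k.
    by rewrite !inE => /existsP[j /sub e]; apply/existsP; exists j.
  - apply: leq_ltn_trans ns; apply: subset_leq_card; apply/fintype.subsetP => y.
    by rewrite !inE => /sub.
have sup y : s y != i -> t y != i by rewrite et ffunE; case: (eqVneq y x).
have pM : (#|defect_rows s| <= #|defect_rows t|)%N.
  apply: subset_leq_card; apply/fintype.subsetP => j.
  by rewrite !inE => /existsP[k /sup e]; apply/existsP; exists k.
have qM : (#|defect_columns s| <= #|defect_columns t|)%N.
  apply: subset_leq_card; apply/fintype.subsetP => k.
  by rewrite !inE => /existsP[j /sup e]; apply/existsP; exists j.
have pt : (#|defect_rows t| <= m.+2)%N by apply: leq_trans pS _.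
have qt : (#|defect_columns t| <= m.+2)%N by apply: leq_trans qS _.
have low := perimeter_lower (leq_ltn_trans pt mK) (leq_ltn_trans qt mL).
apply: le_trans low; rewrite -[leRHS]addrA lerD2l.
have cs := card_defects s; have ct := card_defects t.
have nle : (#|defects t| <= m.+1 * m + 1)%N by apply: leq_trans nS ns.
(* Exit by area, by a new column or by a new row. For a new line, the area of [t] is at most that of
   the box around [s] plus one. *)
have [nbig|nsmall] := leqP (m.+1 * m + 1) #|defects t|.
  apply: droplet_barrier => //; left; split=> //.
  by apply/eqP; rewrite eqn_leq nle nbig.
have [qbig|qsmall] := ltnP m.+1 #|defect_columns t|.
  apply: droplet_barrier => //; right; split.
    by apply/eqP; rewrite eqn_leq qt qbig.
  apply: leq_trans nS _; rewrite addn1 ltnS; apply: leq_trans cs _.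
  exact: leq_mul.
have [pbig|psmall] := ltnP m.+1 #|defect_rows t|.
  rewrite [X in 2 * X]addrC; apply: droplet_barrier => //; right; split.
    by apply/eqP; rewrite eqn_leq pt pbig.
  apply: leq_trans nS _; rewrite addn1 ltnS; apply: leq_trans cs _.
  by rewrite mulnC; apply: leq_mul.
by case/negP: nt; apply/and3P.
Qed.

Lemma small_droplet_const m : small_droplet m (const_config K L i).
Proof.
have d0 : defects (const_config K L i) = finset.set0.
  by apply/setP => x; rewrite !inE ffunE eqxx.
have r0 : defect_rows (const_config K L i) = finset.set0.
  by apply/setP => x; rewrite !inE; apply/negbTE/existsPn => k; rewrite ffunE eqxx.
have c0 : defect_columns (const_config K L i) = finset.set0.
  by apply/setP => x; rewrite !inE; apply/negbTE/existsPn => k; rewrite ffunE eqxx.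
by rewrite /small_droplet d0 r0 c0 !cards0 addn1.
Qed.

Lemma not_small_droplet_const m c : c != i -> (m.+1 < K)%N ->
  ~~ small_droplet m (const_config K L c).
Proof.
move=> ci mK; apply/negP => /and3P[+ _ _]; apply/negP; rewrite -ltnNge.
have L0 : (0 < L)%N by apply: leq_trans L_gt2.
suff -> : defect_rows (const_config K L c) = [set: 'I_K]%SET by rewrite cardsT card_ord.
apply/setP => j; rewrite !inE; apply/existsP; exists (Ordinal L0).
by rewrite ffunE.
Qed.

End Cut.

(** * Capacity estimates *)

Lemma critical_lengthP (R : realType) (x : R) : 0 < x -> x < 1 ->
  exists m : nat, [/\ critical_length x = m.+1%:R, x * m%:R < 2 & 2 <= x * m.+1%:R].
Proof.
move=> x0 x1; rewrite /critical_length.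
have q0 : 0 < 2 / x by rewrite divr_gt0.
have c0 : 0 < Num.ceil (2 / x) by rewrite ceil_gt0.
have lo := ceilB1_lt (2 / x); have hi := ceil_ge (2 / x).
case: (Num.ceil (2 / x)) c0 lo hi => // -[|m] // _ lo hi.
exists m; split=> //.
  have -> : x * m%:R = (Posz m.+1 - 1)%:~R * x.
    by rewrite -addn1 PoszD addrK mulrC.
  by rewrite -ltr_pdivlMr.
by move: hi; rewrite ler_pdivrMr // mulrC.
Qed.

(** The expression is concave in [k] with increments [4 - 2 x k], which change sign at [2 / x], so
    the critical length maximises it. The factorisation in the proof makes both signs visible. *)
Lemma barrier_max (R : realType) (x : R) (k : nat) : 0 < x -> x < 1 ->
  4 * k%:R - x * (k%:R * (k%:R - 1) + 1) <= barrier x.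
Proof.
move=> x0 x1; have [m [e lo hi]] := critical_lengthP x0 x1; rewrite /barrier e /=.
move: lo hi; rewrite -[m.+1%:R]natr1; set M : R := m%:R => lo hi.
have fac : 4 * (M + 1) - x * ((M + 1) * (M + 1 - 1) + 1) -
  (4 * k%:R - x * (k%:R * (k%:R - 1) + 1)) = (M + 1 - k%:R) * (4 - x * (M + k%:R)) by ring.
rewrite -subr_ge0 fac; have [km|mk|->] := ltngtP k m.+1.
- have kM : (k%:R : R) <= M by rewrite ler_nat.
  have := ler_wpM2l (ltW x0) kM => xk; apply: mulr_ge0; lra.
- have kM : M + 1 + 1 <= (k%:R : R) by rewrite !natr1 ler_nat.
  have := ler_wpM2l (ltW x0) kM => xk; rewrite -mulrNN; apply: mulr_ge0; lra.
- by rewrite -[m.+1%:R]natr1 subrr mul0r.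
Qed.

(** A maximum over [k] of functions that strictly decrease in the field: the maximiser for [y]
    already does better at [x]. *)
Lemma barrier_decreasing (R : realType) (x y : R) : 0 < x -> x < y -> y < 1 ->
  barrier y < barrier x.
Proof.
move=> x0 xy y1; have y0 := lt_trans x0 xy.
have [m [e _ _]] := critical_lengthP y0 y1.
apply: lt_le_trans (barrier_max m.+1 x0 (lt_trans xy y1)).
rewrite /barrier e /= ltrD2l ltrN2 ltr_pM2r // ltr_wpDl //.
Qed.

Lemma generatorE (R : realType) (S : finType) (c : S -> S -> R) (v : S -> R) x :
  \sum_y generator c x y * v y = \sum_y c x y * (v y - v x).
Proof.
rewrite (bigD1 x) //= [RHS](bigD1 x) //= subrr mulr0 add0r.
under [RHS]eq_bigr => y _ do rewrite mulrBr.
rewrite sumrB -mulr_suml /generator eqxx mulNr addrC; congr (_ - _).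
by apply: eq_bigr => y yx; rewrite eq_sym (negbTE yx).
Qed.

Section Weights.
Variables (K L : nat) (R : realType) (h : spin -> R) (beta : R).
Hypothesis beta_gt0 : 0 < beta.
Notation config := (config K L).
Local Notation H := (hamiltonian (K := K) (L := L) h).

Definition weight (s t : config) : R := expR (- (beta * H s)) * rate h beta s t.

Lemma rate_ge0 (s t : config) : 0 <= rate h beta s t.
Proof. by rewrite /rate; case: ifP => // _; exact: expR_ge0. Qed.

Lemma weightE s t :
  weight s t = if adjacent s t then expR (- (beta * Num.max (H s) (H t))) else 0.
Proof.
rewrite /weight /rate /adjacent; case: ifP => _; last by rewrite mulr0.
rewrite -expRD; congr expR; have [st|ts] := leP (H s) (H t).
  by rewrite max_l ?subr_ge0 //; ring.
by rewrite max_r ?subr_le0 ?(ltW ts) //; ring.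
Qed.

Lemma weight_ge0 s t : 0 <= weight s t.
Proof. by rewrite mulr_ge0 ?rate_ge0 ?expR_ge0. Qed.

Lemma weight_sym s t : weight s t = weight t s.
Proof. by rewrite !weightE adjacent_sym maxC. Qed.

Lemma weight_le s t E : E <= Num.max (H s) (H t) -> weight s t <= expR (- (beta * E)).
Proof.
rewrite weightE => le; case: ifP => _; last exact: expR_ge0.
by rewrite ler_expR lerN2 ler_pM2l.
Qed.

Lemma weight_ge s t E : adjacent s t -> H s <= E -> H t <= E ->
  expR (- (beta * E)) <= weight s t.
Proof.
by move=> st sE tE; rewrite weightE st ler_expR lerN2 ler_pM2l // ge_max sE.
Qed.

Lemma weight_connected s t : connect (fun s t => 0 < weight s t) s t.
Proof.
have [n] := ubnP #|[set x | s x != t x]%SET|; elim: n s => // n IH s.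
rewrite ltnS => le; have [->|/eqP st] := eqVneq s t; first exact: connect0.
have [x sx] : exists x, s x != t x.
  apply: contrapT => nx; apply: st; apply/ffunP => x; apply/eqP/negPn/negP => sx.
  by apply: nx; exists x.
have tx : t x != s x by rewrite eq_sym.
apply: (@connect_trans _ _ (upd s x (t x))).
  by apply: connect1; rewrite weightE adjacent_upd // expR_gt0.
apply: IH; apply: leq_trans le; apply: proper_card; apply/properP; split.
  apply/fintype.subsetP => y; rewrite !inE ffunE; case: ifP => // /eqP ->.
  by rewrite eqxx.
by exists x; rewrite !inE // upd_same eqxx.
Qed.

Lemma lap_weight (v : config -> R) s :
  \sum_t generator (rate h beta) s t * v t = expR (beta * H s) * lap weight v s.
Proof.
rewrite generatorE /lap mulr_sumr; apply: eq_bigr => t _.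
by rewrite /weight !mulrA -expRD addrN expR0 mul1r.
Qed.

End Weights.

(** * Absorption, committor and hitting time for the Potts chain *)

Section Metastability.
Variables (K L : nat) (R : realType) (h : spin -> R).
Hypothesis K_gt2 : (2 < K)%N.
Hypothesis L_gt2 : (2 < L)%N.
Hypothesis h12_gt0 : 0 < h spin2 - h spin1.
Hypothesis h12_lt1 : h spin2 - h spin1 < 1.
Hypothesis h23_gt0 : 0 < h spin3 - h spin2.
Hypothesis h13_lt1 : h spin3 - h spin1 < 1.
Notation config := (config K L).
Local Notation H := (hamiltonian (K := K) (L := L) h).
Local Notation s1 := (const_config K L spin1).
Local Notation s2 := (const_config K L spin2).
Local Notation s3 := (const_config K L spin3).
Local Notation n := (#|{: config}|%:R : R).

Let K0 : (0 < K)%N. Proof. exact: leq_trans K_gt2. Qed.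
Let L0 : (0 < L)%N. Proof. exact: leq_trans L_gt2. Qed.

Lemma const_config_inj i j : const_config K L i = const_config K L j -> i = j.
Proof. by move/ffunP/(_ (Ordinal K0, Ordinal L0)); rewrite !ffunE. Qed.

Lemma ising_const i : i != spin3 -> ising (const_config K L i).
Proof. by move=> i3; apply/forallP => x; rewrite ffunE. Qed.

Lemma not_ising_s3 : ~~ ising s3.
Proof. by apply/negP => /forallP/(_ (Ordinal K0, Ordinal L0)); rewrite ffunE eqxx. Qed.

Lemma field_le c : h c <= h spin3.
Proof.
have h23 : h spin2 <= h spin3 by move: h23_gt0; lra.
have h13 : h spin1 <= h spin3 by move: h12_gt0 h23; lra.
have [->|[->|->]] // : c = spin1 \/ c = spin2 \/ c = spin3.
by case: c => -[|[|[|//]]] ?; [left|right; left|right; right]; exact: val_inj.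
Qed.

Let gamma : R := (2 * (n + 1))^-1.

(** [gamma] is the factor lost in one use of [descent_lower], and the descents are at most as many
    as the configurations. The bound is free of [beta]. *)
Definition escape_bound : R := gamma ^+ #|{: config}|.

Section FixedBeta.
Variables (beta : R) (k : nat).
Hypothesis beta_gt0 : 0 < beta.
Hypothesis k_gt0 : (0 < k)%N.
Hypothesis k_leK : (k <= K)%N.
Hypothesis k_leL : (k <= L)%N.
Hypothesis k_grow : 2 < (h spin2 - h spin1) * k%:R.
Hypothesis k_shrink : forall m, (m < k)%N -> (h spin2 - h spin1) * m%:R < 2.
Hypothesis beta_large : 2 * n ^+ 3 <=
  expR (beta * ((h spin2 - h spin1) - (h spin3 - h spin2))).
Local Notation a := (weight h beta).
Local Notation lap := (lap a).

Let a_sym (s t : config) : a s t = a t s. Proof. exact: weight_sym. Qed.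
Let a_ge0 (s t : config) : 0 <= a s t. Proof. exact: weight_ge0. Qed.
Let a_conn (s t : config) : connect (fun s t => 0 < a s t) s t.
Proof. exact: weight_connected. Qed.

(** Creating a 3 at [x] competes with the other flips at [x]. If one of them leads to an Ising
    configuration below [H s], its weight is [expR (- (beta * H y))], at least that of the creation.
    Otherwise both Ising values at [x] have energy at least [H s], and [third_spin_cost] applies. *)
Lemma creation_weight (s y b : config) (W : pred config) :
  ising y -> H s <= H y -> ~~ ising b ->
  (forall t, ising t -> H t < H s -> t \in W) ->
  a y b <= \sum_(x in W) a y x + expR (- (beta * (H s + 2 - (h spin3 - h spin2)))).
Proof.
move=> iy sy ib lowW.
have sum0 : 0 <= \sum_(x in W) a y x by apply: sumr_ge0.
have [/adjacentP[x [c [cx eb]]]|nadj] := boolP (adjacent y b); last first.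
  by rewrite weightE (negbTE nadj) addr_ge0 // expR_ge0.
have c3 : c = spin3.
  by apply/eqP; apply: contraNT ib => c3; rewrite eb ising_upd.
pose y' c' := upd y x c'.
have [/existsP[c' /andP[c'3 low]]|/existsPn high] :=
    boolP [exists c', (c' != spin3) && (H (y' c') < H s)].
  have iy' : ising (y' c') by apply: ising_upd.
  have yc' : c' != y x.
    apply/eqP => e; move: low; rewrite ltNge; suff -> : y' c' = y by rewrite sy.
    by apply/ffunP => z; rewrite ffunE; case: eqVneq => // ->.
  rewrite ler_wpDr ?expR_ge0 // (bigD1 (y' c')) /=; last exact: lowW.
  rewrite ler_wpDr ?sumr_ge0 //.
  apply: (@le_trans _ _ (expR (- (beta * H y)))).
    by apply: weight_le => //; rewrite le_max lexx.
  apply: weight_ge => //; first exact: adjacent_upd.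
  exact: le_trans (ltW low) sy.
have high' c' : c' != spin3 -> H s <= H (y' c').
  by move=> c'3; have := high c'; rewrite c'3 /= -leNgt.
rewrite ler_wpDl //; apply: weight_le => //; rewrite le_max; apply/orP; right.
rewrite eb c3; apply: third_spin_cost => //; first by rewrite -subr_gt0.
- exact: high'.
- exact: high'.
Qed.


Lemma n_ge1 : 1 <= n.
Proof. by rewrite ler1n; apply/card_gt0P; exists s1. Qed.

Let gamma_gt0 : 0 < gamma.
Proof. by rewrite invr_gt0; have := n_ge1; lra. Qed.

Let gamma_le1 : gamma <= 1.
Proof. by rewrite invf_le1; have := n_ge1; lra. Qed.

(** [f] is the probability of meeting 1 or 2 before a 3. The induction is on the number of Ising
    configurations of lower energy; each descent loses a factor [gamma]. *)
Lemma absorption_lower (f : config -> R) :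
  (forall s, 0 <= f s) -> f s1 = 1 -> f s2 = 1 -> (forall s, ~~ ising s -> f s = 0) ->
  (forall s, ising s -> s != s1 -> s != s2 -> lap f s = 0) ->
  forall s, ising s -> escape_bound <= f s.
Proof.
move=> f0 f1 f2 fB har.
pose rank s := #|[set t | ising t && (H t < H s)]%SET|.
suff main j : forall s, ising s -> (rank s <= j)%N -> gamma ^+ j <= f s.
  by move=> s si; apply: main => //; apply: max_card.
elim: j => [|j IH] s si rs.
  have [->|n1] := eqVneq s s1; first by rewrite f1.
  have [->|n2] := eqVneq s s2; first by rewrite f2.
  have [t [ti ts _]] := ising_descent K_gt2 L_gt2 h12_gt0 h12_lt1 si n1 n2
    k_gt0 k_leK k_leL k_grow k_shrink.
  have : t \in [set t | ising t && (H t < H s)]%SET by rewrite inE ti.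
  by move: rs; rewrite leqn0 cards_eq0 => /eqP ->; rewrite inE.
have pow1 m : gamma ^+ m <= 1 by rewrite exprn_ile1 // ltW.
have [->|n1] := eqVneq s s1; first by rewrite f1.
have [->|n2] := eqVneq s s2; first by rewrite f2.
have [t [ti ts ct]] := ising_descent K_gt2 L_gt2 h12_gt0 h12_lt1 si n1 n2
  k_gt0 k_leK k_leL k_grow k_shrink.
pose W : pred config := fun x => ising x && [|| H x < H s, x == s1 | x == s2].
pose B : pred config := fun x => ~~ ising x.
have i1 : ising s1 by apply: ising_const.
have i2 : ising s2 by apply: ising_const.
pose e := expR (- (beta * (H s + 2 - (h spin2 - h spin1)))).
pose kap := expR (- (beta * (H s + 2 - (h spin3 - h spin2)))).
suff : gamma ^+ j <= 2 * (n + 1) * f s.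
  have g1 : 0 < 2 * (n + 1) by have := n_ge1; lra.
  by rewrite exprS /gamma -ler_pdivlMl ?invr_gt0 // invrK.
apply: (@descent_lower R _ a a_sym a_ge0 a_conn W B f s t
  (ising_step h (H s + 2 - (h spin2 - h spin1))) (gamma ^+ j) e kap) => //.
- move=> x xW xB; have xi : ising x by move: xB; rewrite !unfold_in negbK.
  move: xW; rewrite unfold_in xi /= !negb_or => /and3P[_ x1 x2]; exact: har.
- exact: exprn_ge0 (ltW gamma_gt0).
- move=> x; rewrite unfold_in => /andP[xi /or3P[xs|/eqP ->|/eqP ->]].
  + apply: IH => //; rewrite -ltnS; apply: leq_trans rs.
    apply: proper_card; apply/properP; split.
      apply/fintype.subsetP => y; rewrite !inE => /andP[-> yx] /=.
      exact: lt_trans yx xs.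
    by exists x; rewrite !inE xi //= ltxx.
  + by rewrite f1.
  + by rewrite f2.
- by rewrite unfold_in ltxx (negbTE n1) (negbTE n2) andbF.
- by rewrite unfold_in si.
- by rewrite unfold_in ti ts.
- by move=> x y /and5P[_ _ xy hx hy]; apply: weight_ge.
- exact: expR_ge0.
- move=> y b yW yB bB; have yi : ising y by move: yB; rewrite unfold_in negbK.
  apply: creation_weight => //.
    by move: yW; rewrite unfold_in yi /= !negb_or => /and3P[]; rewrite -leNgt.
  by move=> x xi xs; rewrite unfold_in xi xs.
- by move=> b; rewrite !unfold_in => /andP[->].
(* The ratio [e / kap] is [expR (beta * (h12 - h23))], where [h12] and [h23] are the two field gaps;
   this is where [beta_large] and the sign of their difference enter. *)
- rewrite /e (_ : - (beta * _) = - (beta * (H s + 2 - (h spin3 - h spin2))) +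
    beta * ((h spin2 - h spin1) - (h spin3 - h spin2))); last by ring.
  by rewrite expRD mulrC ler_wpM2l // expR_ge0.
- exact: expR_gt0.
Qed.

(** [g] and [g'] are the probabilities of meeting 1, respectively 2, first and before any 3. Their
    sum is the absorption probability, bounded below on the whole path by [absorption_lower]. *)
Lemma ising_flow_lower (M : R) (g g' : config -> R) :
  connect (ising_step h M) s1 s2 ->
  (forall s, 0 <= g s) -> (forall s, 0 <= g' s) ->
  g s1 = 1 -> g' s1 = 0 -> g s2 = 0 -> g' s2 = 1 ->
  (forall s, ~~ ising s -> g s = 0) -> (forall s, ~~ ising s -> g' s = 0) ->
  (forall s, ising s -> s != s1 -> s != s2 -> lap g s = 0 /\ lap g' s = 0) ->
  escape_bound ^+ 2 * expR (- (beta * M)) <= n * lap g s2.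
Proof.
move=> path12 g0 g'0 g1 g'1 g2 g'2 gB g'B har.
have low := @absorption_lower (fun s => g s + g' s).
apply: (flow_lower a_sym a_ge0 g0 g'0 g1 g'1 g2 g'2 _ _ (expR_ge0 _) path12).
- move=> x x1 x2; have [xi|xi] := boolP (ising x).
    by have [-> ->] := har x xi x1 x2; rewrite !mulr0.
  by rewrite gB // g'B // !mul0r.
- exact: exprn_gt0.
- have low' : forall s, ising s -> escape_bound <= g s + g' s.
    apply: low => [s|||s si|s si n1 n2]; first by rewrite addr_ge0.
    + by rewrite g1 g'1 addr0.
    + by rewrite g2 g'2 add0r.
    + by rewrite gB // g'B // addr0.
    + by rewrite lapD; have [-> ->] := har s si n1 n2; rewrite addr0.
  by move=> x y /and5P[xi yi xy hx hy]; split; [exact: weight_ge|exact: low'|exact: low'].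
Qed.

(** With [q] the voltage at 1 when 2 and 3 are grounded, Green's formula gives [v s1] as the current
    of [q] into 2 divided by its total current out of 1. *)
Lemma committor_lower (M13 M12 : R) (m13 : nat) :
  (m13.+3 <= K)%N -> (m13.+3 <= L)%N -> 2 <= (h spin3 - h spin1) * m13.+1%:R ->
  M13 = 4 * m13.+1%:R - (h spin3 - h spin1) * (m13.+1%:R * (m13.+1%:R - 1) + 1) ->
  connect (ising_step h (H s1 + M12)) s1 s2 ->
  forall v : config -> R, v s2 = 1 -> v s3 = 0 ->
  (forall s, s != s2 -> s != s3 -> lap v s = 0) ->
  escape_bound ^+ 2 * expR (- (beta * M12)) <=
    n ^+ 3 * expR (- (beta * M13)) * v s1.
Proof.
move=> mK mL hm2 eM path12 v v2 v3 vhar.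
have i1 : ising s1 by apply: ising_const.
have i2 : ising s2 by apply: ising_const.
have s12 : s1 != s2 by apply/eqP => /const_config_inj.
have s13 : s1 != s3 by apply/eqP => /const_config_inj.
have s23 : s2 != s3 by apply/eqP => /const_config_inj.
pose Z : pred config := fun s => [|| s == s1, s == s2 | ~~ ising s].
have Z1 : s1 \in Z by rewrite unfold_in eqxx.
have Z2 : s2 \in Z by rewrite unfold_in eqxx orbT.
have ZB s : ~~ ising s -> s \in Z by rewrite unfold_in => ->; rewrite !orbT.
have nZ s : ising s -> s != s1 -> s != s2 -> s \notin Z.
  by move=> si n1 n2; rewrite unfold_in (negbTE n1) (negbTE n2) si.
have [g gZ ghar] := harmonic_extension a_ge0 a_conn (fun s => (s == s1)%:R) Z1.
have [g' g'Z g'har] := harmonic_extension a_ge0 a_conn (fun s => (s == s2)%:R) Z1.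
have g01 : forall s, 0 <= g s <= 1.
  apply: (harmonic_01 a_ge0 a_conn Z1 ghar) => s sZ.
  by rewrite gZ //; case: eqP; rewrite ?lexx ?ler01.
have g'01 : forall s, 0 <= g' s <= 1.
  apply: (harmonic_01 a_ge0 a_conn Z1 g'har) => s sZ.
  by rewrite g'Z //; case: eqP; rewrite ?lexx ?ler01.
have notB s t : ising t -> ~~ ising s -> (s == t) = false.
  by move=> ti; apply: contraNF => /eqP ->.
have flow : escape_bound ^+ 2 * expR (- (beta * (H s1 + M12))) <= n * lap g s2.
  apply: (ising_flow_lower (g' := g')) => //.
  - by move=> s; case/andP: (g01 s).
  - by move=> s; case/andP: (g'01 s).
  - by rewrite gZ // eqxx.
  - by rewrite g'Z // (negbTE s12).
  - by rewrite gZ // eq_sym (negbTE s12).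
  - by rewrite g'Z // eqxx.
  - by move=> s sB; rewrite gZ ?ZB // notB.
  - by move=> s sB; rewrite g'Z ?ZB // notB.
  - by move=> s si n1 n2; rewrite ghar ?g'har ?nZ.
pose Y : pred config := fun s => [|| s == s1, s == s2 | s == s3].
have Y1 : s1 \in Y by rewrite unfold_in eqxx.
have Y2 : s2 \in Y by rewrite unfold_in eqxx orbT.
have Y3 : s3 \in Y by rewrite unfold_in eqxx !orbT.
have [q qY qhar] := harmonic_extension a_ge0 a_conn (fun s => (s == s1)%:R) Y1.
have q01 : forall s, 0 <= q s <= 1.
  apply: (harmonic_01 a_ge0 a_conn Y1 qhar) => s sY.
  by rewrite qY //; case: eqP; rewrite ?lexx ?ler01.
have q1 : q s1 = 1 by rewrite qY // eqxx.
have q2 : q s2 = 0 by rewrite qY // eq_sym (negbTE s12).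
have q3 : q s3 = 0 by rewrite qY // eq_sym (negbTE s13).
have g2 : g s2 = 0 by rewrite gZ // eq_sym (negbTE s12).
(* Grounding all configurations that contain a 3 only lowers the voltage. As both functions vanish
   at 2, the current into 2 is lowered too. *)
have qg s : g s <= q s.
  rewrite -subr_ge0.
  apply: (@min_principle R _ a a_ge0 a_conn Z (fun s => q s - g s) s1 Z1) => t tZ.
    rewrite lapB ghar // subr0; have tY : t \notin Y; last by rewrite qhar.
    move: tZ; rewrite !unfold_in !negb_or => /and3P[-> -> /=]; rewrite negbK => ti.
    by apply/eqP => e; move: ti; rewrite e (negbTE not_ising_s3).
  rewrite gZ //; case: eqVneq => [->|_]; first by rewrite q1 subrr.
  by rewrite subr0; case/andP: (q01 t).
have lapq : lap g s2 <= lap q s2.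
  rewrite (lap_zero _ g2) (lap_zero _ q2); apply: ler_sum => t _.
  by rewrite ler_wpM2l.
(* The cut around 1 credits every defect with [h spin3 - h spin1], so it gives the barrier of a
   droplet of 3s even for droplets that mix 2s and 3s. *)
have cap : - lap q s1 <= n ^+ 2 * expR (- (beta * (H s1 + M13))).
  apply: (@cap_upper R _ a a_sym a_ge0 q s1 (small_droplet spin1 m13)) => //.
  - exact: small_droplet_const.
  - move=> s sA n1; apply: qhar; rewrite unfold_in (negbTE n1) /=.
    have ns c : c != spin1 -> s != const_config K L c.
      move=> c1; apply/eqP => es; move: sA; rewrite unfold_in es; apply/negP.
      by apply: not_small_droplet_const => //; apply: leq_trans mK; rewrite ltnS.
    by rewrite negb_or !ns.
  - move=> s t sA tA; have [st|st] := boolP (adjacent s t); last first.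
      by rewrite weightE (negbTE st) expR_ge0.
    apply: weight_le => //; rewrite le_max eM; apply/orP; right.
    apply: (small_droplet_exit K_gt2 L_gt2 _ _ mK mL hm2 sA tA st).
      by rewrite subr_ge0 field_le.
    by move=> c; rewrite lerD2r field_le.
have green : v s1 * (- lap q s1) = lap q s2.
  have e := lap_green a_sym q v.
  have e0 : \sum_s q s * lap v s = 0.
    apply: big1 => s _; have [->|n2] := eqVneq s s2; first by rewrite q2 mul0r.
    have [->|n3] := eqVneq s s3; first by rewrite q3 mul0r.
    by rewrite vhar // mulr0.
  have e1 : \sum_s v s * lap q s = v s1 * lap q s1 + lap q s2.
    rewrite (bigD1 s1) //= (bigD1 s2) /=; last by rewrite eq_sym.
    rewrite v2 mul1r big1 ?addr0 // => s /andP[n1 n2].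
    have [->|n3] := eqVneq s s3; first by rewrite v3 mul0r.
    by rewrite qhar ?mulr0 // unfold_in (negbTE n1) (negbTE n2) (negbTE n3).
  by move: e; rewrite e0 e1; lra.
have v01 : forall s, 0 <= v s <= 1.
  pose V : pred config := fun s => (s == s2) || (s == s3).
  have V2 : s2 \in V by rewrite unfold_in eqxx.
  apply: (harmonic_01 a_ge0 a_conn V2) => s; rewrite unfold_in ?negb_or.
    by case/andP; apply: vhar.
  by case/orP => /eqP ->; rewrite ?v2 ?v3 ?lexx ?ler01.
have /andP[v1 _] := v01 s1.
have n0 : 0 <= n by have := n_ge1; lra.
have chain : escape_bound ^+ 2 * expR (- (beta * (H s1 + M12))) <=
    n * (v s1 * (n ^+ 2 * expR (- (beta * (H s1 + M13))))).
  apply: le_trans flow _; rewrite ler_wpM2l //; apply: le_trans lapq _.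
  by rewrite -green ler_wpM2l.
have split M : expR (- (beta * (H s1 + M))) = expR (- (beta * H s1)) * expR (- (beta * M)).
  by rewrite -expRD; congr expR; ring.
rewrite -(ler_pM2l (expR_gt0 (- (beta * H s1)))).
by move: chain; rewrite !split !exprS expr0; lra.
Qed.

(** The bound is [v s1 / (e * eps)]. The cut around 2 gives [eps] with a factor [n ^ 2], and
    [committor_lower] contributes [n ^ 3]; hence [n ^ 5]. *)
Lemma hitting_time_lower (M13 M12 M23 : R) (m13 m23 : nat)
    (d : measure_display) (Omega : measurableType d) (P : probability Omega R)
    (X : R -> Omega -> config) :
  (m13.+3 <= K)%N -> (m13.+3 <= L)%N -> 2 <= (h spin3 - h spin1) * m13.+1%:R ->
  M13 = 4 * m13.+1%:R - (h spin3 - h spin1) * (m13.+1%:R * (m13.+1%:R - 1) + 1) ->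
  (m23.+3 <= K)%N -> (m23.+3 <= L)%N -> 2 <= (h spin3 - h spin2) * m23.+1%:R ->
  M23 = 4 * m23.+1%:R - (h spin3 - h spin2) * (m23.+1%:R * (m23.+1%:R - 1) + 1) ->
  connect (ising_step h (H s1 + M12)) s1 s2 ->
  is_markov_chain (rate h beta) s1 P X ->
  ((expR (- 1) * escape_bound ^+ 2 / n ^+ 5 *
    expR (beta * (M23 + M13 - M12)))%:E <= expected_hitting_time P X s3)%E.
Proof.
move=> mK mL hm2 eM mK' mL' hm2' eM' path12 chain.
have s12 : s1 != s2 by apply/eqP => /const_config_inj.
have s23 : s2 != s3 by apply/eqP => /const_config_inj.
pose V : pred config := fun s => (s == s2) || (s == s3).
have V2 : s2 \in V by rewrite unfold_in eqxx.
have V3 : s3 \in V by rewrite unfold_in eqxx orbT.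
have [v vV vhar'] := harmonic_extension a_ge0 a_conn (fun s => (s == s2)%:R) V2.
have v2 : v s2 = 1 by rewrite vV // eqxx.
have v3 : v s3 = 0 by rewrite vV // eq_sym (negbTE s23).
have v01 : forall s, 0 <= v s <= 1.
  apply: (harmonic_01 a_ge0 a_conn V2 vhar') => s sV.
  by rewrite vV //; case: eqP; rewrite ?lexx ?ler01.
have vhar s : s != s2 -> s != s3 -> lap v s = 0.
  by move=> n2 n3; apply: vhar'; rewrite unfold_in (negbTE n2) (negbTE n3).
have v0 s : 0 <= v s by case/andP: (v01 s).
have n0 : 0 < n by have := n_ge1; lra.
have cap : - lap v s2 <= n ^+ 2 * expR (- (beta * (H s2 + M23))).
  apply: (@cap_upper R _ a a_sym a_ge0 v s2 (small_droplet spin2 m23)) => //.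
  - exact: small_droplet_const.
  - move=> s sA n2; apply: vhar => //; apply/eqP => es; move: sA; rewrite unfold_in es.
    by apply/negP; apply: not_small_droplet_const => //; apply: leq_trans mK'; rewrite ltnS.
  - move=> s t sA tA; have [st|st] := boolP (adjacent s t); last first.
      by rewrite weightE (negbTE st) expR_ge0.
    apply: weight_le => //; rewrite le_max eM'; apply/orP; right.
    apply: (small_droplet_exit K_gt2 L_gt2 _ _ mK' mL' hm2' sA tA st).
      exact: ltW.
    by move=> c; rewrite lerD2r field_le.
pose eps := n ^+ 2 * expR (- (beta * M23)).
have eps0 : 0 < eps by rewrite mulr_gt0 ?exprn_gt0 ?expR_gt0.
(* Only three cases: at 2 the capacity bound, at 3 a zero of the nonnegative function [v], elsewhere
   harmonicity. *)
have sub s : - (eps * v s) <= \sum_t generator (rate h beta) s t * v t.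
  rewrite lap_weight; have [->|n2] := eqVneq s s2.
    rewrite v2 mulr1 -[leRHS]opprK lerN2 -mulrN.
    apply: le_trans (ler_wpM2l (expR_ge0 _) cap) _.
    rewrite mulrCA -expRD /eps ler_wpM2l ?exprn_ge0 ?(ltW n0) //.
    by rewrite ler_expR; lra.
  have [->|n3] := eqVneq s s3.
    rewrite v3 mulr0 oppr0 mulr_ge0 ?expR_ge0 //.
    exact: (lap_ge0_zero a_ge0).
  by rewrite vhar // mulr0 oppr_le0 mulr_ge0 // ltW.
apply: le_trans (expected_hitting_time_ge (rate_ge0 h beta) chain v01 v3 eps0 sub).
rewrite lee_fin.
have low := committor_lower mK mL hm2 eM path12 v2 v3 vhar.
have n3 : 0 < n ^+ 3 by rewrite exprn_gt0.
set G := escape_bound ^+ 2 in low *.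
have v1 : G * expR (- (beta * M12)) / (n ^+ 3 * expR (- (beta * M13))) <= v s1.
  by rewrite ler_pdivrMr ?mulr_gt0 ?expR_gt0 // [leRHS]mulrC.
rewrite ler_pdivlMr //; set X' := expR (beta * _).
rewrite (_ : _ * eps = expR (- 1) * (G / n ^+ 5 * X' * eps)); last by ring.
rewrite ler_wpM2l ?expR_ge0 // /X'.
apply: le_trans v1; rewrite le_eqVlt; apply/orP; left; apply/eqP.
have -> : expR (beta * (M23 + M13 - M12)) =
    expR (- (beta * M12)) / expR (- (beta * M23)) / expR (- (beta * M13)).
  by rewrite -!expRN -!expRD; congr expR; ring.
rewrite /eps; field.
by rewrite !gt_eqF ?expR_gt0.
Qed.

End FixedBeta.
End Metastability.

(** * Side lengths, critical lengths and the limit *)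

Lemma side_length (R : realType) (x : R) (N : nat) : 0 < x -> 3 / x < N%:R -> 3 < x * N%:R.
Proof. by move=> x0; rewrite ltr_pdivrMr // mulrC. Qed.

Lemma critical_droplet_fits (R : realType) (x : R) (m N : nat) : 0 < x ->
  x * m%:R < 2 -> 2 + 2 * x <= x * N%:R -> (m.+3 <= N)%N.
Proof.
move=> x0 xm xN; rewrite leqNgt; apply/negP; rewrite ltnS -(ler_nat R) => Nm.
have := ler_wpM2l (ltW x0) Nm; rewrite -[m.+2%:R]natr1 -[m.+1%:R]natr1; lra.
Qed.

Theorem theorem2p8 (R : realType) (K L : nat) (h : spin -> R)
  (K_gt0 : (0 < K)%N) (L_gt0 : (0 < L)%N)
  (h1_gt0 : 0 < h spin1) (h12 : h spin1 < h spin2)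
  (h23 : h spin2 < h spin3) (h3_lt1 : h spin3 < 1)
  (K_gt23 : 3 / (h spin3 - h spin2) < K%:R)
  (K_gt12 : 3 / (h spin2 - h spin1) < K%:R)
  (L_gt23 : 3 / (h spin3 - h spin2) < L%:R)
  (L_gt12 : 3 / (h spin2 - h spin1) < L%:R)
  (nonint : forall a b : int, (a, b) != (0, 0) ->
     a%:~R * (h spin2 - h spin1) + b%:~R * (h spin3 - h spin2)
       \isn't a Num.int) :
  (Gamma h spin1 spin2 < Gamma h spin2 spin3 <->
     h spin1 + h spin3 < 2 * h spin2) /\
  (Gamma h spin1 spin2 < Gamma h spin2 spin3 ->
   forall (d : R -> measure_display)
     (Omega : forall beta : R, measurableType (d beta))
     (P : forall beta : R, probability (Omega beta) R)
     (X : forall beta : R, R -> Omega beta -> config K L),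
   (forall beta : R, 0 < beta ->
      is_markov_chain (rate h beta) (const_config K L spin1)
        (P beta) (X beta)) ->
   ((expR (- (beta * Gamma h spin1 spin3)))%:E *
      expected_hitting_time (P beta) (X beta) (const_config K L spin3))%E
     @[beta --> +oo] --> +oo%E).
Proof.
set d12 := h spin2 - h spin1 in K_gt12 L_gt12 nonint *.
set d23 := h spin3 - h spin2 in K_gt23 L_gt23 nonint *.
have p12 : 0 < d12 by rewrite subr_gt0.
have p23 : 0 < d23 by rewrite subr_gt0.
have e13 : h spin3 - h spin1 = d12 + d23 by rewrite /d12 /d23; ring.
have l13 : d12 + d23 < 1 by rewrite -e13; lra.
have lt12 : d12 < 1 by lra.
have lt23 : d23 < 1 by lra.
have lt13 : h spin3 - h spin1 < 1 by rewrite e13.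
have iff1 : Gamma h spin1 spin2 < Gamma h spin2 spin3 <-> d23 < d12.
  rewrite /Gamma -/d12 -/d23; split=> [G|lt]; last by apply: barrier_decreasing => //; lra.
  rewrite ltNge; apply/negP; rewrite le_eqVlt => /orP[/eqP e|lt].
    by move: G; rewrite e ltxx.
  have := @barrier_decreasing R d12 d23 p12 lt; move: G; lra.
split; first by rewrite iff1 /d12 /d23; split; lra.
move=> Glt d Omega P X chain; have d23_lt := iff1.1 Glt.
have K23 := side_length p23 K_gt23; have L23 := side_length p23 L_gt23.
have K12 := side_length p12 K_gt12; have L12 := side_length p12 L_gt12.
have gt2 N : 3 < d12 * N%:R -> (2 < N)%N.
  move=> hN; rewrite ltnNge; apply/negP; rewrite -(ler_nat R) => N2.
  have := ler_wpM2l (ltW p12) N2; lra.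
have [m12 [c12 lo12 hi12]] := critical_lengthP p12 lt12.
have [m23 [c23 lo23 hi23]] := critical_lengthP p23 lt23.
have p13 : 0 < h spin3 - h spin1 by rewrite e13; lra.
have [m13 [c13 lo13 hi13]] := critical_lengthP p13 lt13.
(* Equality would make the multiple [m12.+1] of [d12] an integer, which assumption (B) with second
   coefficient 0 excludes. *)
have grow : 2 < d12 * m12.+1%:R.
  rewrite lt_neqAle hi12 andbT; apply/eqP => e.
  have := nonint m12.+1%:Z 0 isT; rewrite mul0r addr0 mulrC -[_%:~R]/(m12.+1%:R) -e.
  by rewrite (_ : 2 = 2%:Z%:~R) // intr_int.
have shrink m : (m < m12.+1)%N -> d12 * m%:R < 2.
  rewrite ltnS -(ler_nat R) => mm; have := ler_wpM2l (ltW p12) mm; lra.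
have fits12 N : 3 < d12 * N%:R -> (m12.+1 <= N)%N.
  move=> hN; rewrite ltnNge; apply/negP; rewrite -(ler_nat R) => Nm.
  have := ler_wpM2l (ltW p12) Nm; lra.
(* [d23] is the smaller of two numbers whose sum is below 1. Hence [2 + 2 * d23 < 3], and sides with
   [d23 * N > 3] leave room for [m23 + 3] lines. *)
have d23_half : d23 * 2 < 1 by lra.
have fits23 N : 3 < d23 * N%:R -> (m23.+3 <= N)%N.
  by move=> hN; apply: critical_droplet_fits lo23 _ => //; move: hN d23_half; lra.
have fits13 N : 3 < d23 * N%:R -> (m13.+3 <= N)%N.
  move=> hN; apply: critical_droplet_fits lo13 _ => //.
  have N0 : (0 : R) <= N%:R by rewrite ler0n.
  have : d23 * N%:R <= d12 * N%:R by rewrite ler_wpM2r // ltW.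
  rewrite e13; lra.
have two12 N : 3 < d12 * N%:R -> 2 <= d12 * N%:R by lra.
have path12 := nucleation_path (gt2 K K12) (gt2 L L12) p12 lt12
  (fun k => barrier_max k p12 lt12) (two12 K K12) (two12 L L12).
have M13E : Gamma h spin1 spin3 =
    4 * m13.+1%:R - (h spin3 - h spin1) * (m13.+1%:R * (m13.+1%:R - 1) + 1).
  by rewrite /Gamma /barrier c13.
have M23E : Gamma h spin2 spin3 =
    4 * m23.+1%:R - d23 * (m23.+1%:R * (m23.+1%:R - 1) + 1).
  by rewrite /Gamma /barrier -/d23 c23.
pose n : R := #|{: config K L}|%:R.
pose C : R := expR (- 1) * escape_bound K L R ^+ 2 / n ^+ 5.
have n0 : 0 < n by have := n_ge1 K L R; rewrite -/n; lra.
have C0 : 0 < C.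
  rewrite /C divr_gt0 ?exprn_gt0 // mulr_gt0 ?expR_gt0 //.
  by rewrite exprn_gt0 // /escape_bound exprn_gt0 // invr_gt0; lra.
pose D := Gamma h spin2 spin3 - Gamma h spin1 spin2.
have D0 : 0 < D by rewrite subr_gt0.
have d0 : 0 < d12 - d23 by rewrite subr_gt0.
apply/cvgeyPge => A; near=> beta.
have b0 : 0 < beta by near: beta; apply: nbhs_pinfty_gt; rewrite num_real.
(* Both thresholds rest on [1 + x <= expR x]: [b1] gives the hypothesis [large], and [b2] makes
   [C * expR (beta * D)] at least [A]. *)
have b1 : 2 * n ^+ 3 / (d12 - d23) <= beta.
  by near: beta; apply: nbhs_pinfty_ge; rewrite num_real.
have b2 : A / C / D <= beta by near: beta; apply: nbhs_pinfty_ge; rewrite num_real.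
have large : 2 * n ^+ 3 <= expR (beta * (d12 - d23)).
  rewrite ler_pdivrMr // in b1; apply: le_trans b1 _.
  by have := expR_ge1Dx (beta * (d12 - d23)); lra.
have low := hitting_time_lower (gt2 K K12) (gt2 L L12) p12 lt12 p23
  lt13 b0 (ltn0Sn m12) (fits12 K K12) (fits12 L L12) grow shrink
  large (fits13 K K23) (fits13 L L23) hi13 M13E (fits23 K K23) (fits23 L L23) hi23 M23E
  path12 (chain beta b0).
apply: (@le_trans _ _ ((expR (- (beta * Gamma h spin1 spin3)))%:E * (C *
  expR (beta * (Gamma h spin2 spin3 + Gamma h spin1 spin3 - Gamma h spin1 spin2)))%:E)%E);
  last by rewrite lee_pmul2l // lte_fin expR_gt0.
rewrite -EFinM lee_fin mulrCA -expRD.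
have -> : - (beta * Gamma h spin1 spin3) + beta * (Gamma h spin2 spin3 +
    Gamma h spin1 spin3 - Gamma h spin1 spin2) = beta * D by rewrite /D; ring.
rewrite ler_pdivrMr // ler_pdivrMr // in b2; apply: le_trans b2 _.
rewrite mulrC ler_pM2l //.
by have := expR_ge1Dx (beta * D); lra.
Unshelve. all: by end_near.
Qed.
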